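(* Let $\Omega\subseteq\mathbb{R}^d$ be measurable and let $\mu$ be a probability measure on $\Omega$ with density $p$. Let $\mathbf{A}$ be a tall quasimatrix over $L_2(\Omega,d\mu)$ with $n$ columns, let $\mathbf{b}\in L_2(\Omega,d\mu)$, and let $\lambda\ge0$; if $\lambda=0$, assume that $\mathbf{A}$ has full rank. Let $\mathbf{z}_{\mathbf{A}}:\Omega\to\mathbb{C}^n$ and $\mathbf{z}_{\mathbf{b}}:\Omega\to\mathbb{C}$ be coordinate representations of $\mathbf{A}$ and $\mathbf{b}$. Let $[\mathbf{A}\ \mathbf{b}]$ be the tall quasimatrix with $n+1$ columns obtained by appending $\mathbf{b}$ to $\mathbf{A}$, with coordinate representation $\eta\mapsto(\mathbf{z}_{\mathbf{A}}(\eta),\mathbf{z}_{\mathbf{b}}(\eta))\in\mathbb{C}^{n+1}$, and let $\hat{\mathbf{G}}=[\mathbf{A}\ \mathbf{b}]^*[\mathbf{A}\ \mathbf{b}]\in\mathbb{C}^{(n+1)\times(n+1)}$. Assume that $\hat{\mathbf{G}}+\lambda\mathbf{I}_{n+1}$ is invertible and that the spectral norm satisfies $\|\hat{\mathbf{G}}\|_2\ge\lambda$. Let $\tau_\lambda$ be the $\lambda$-leverage function of $[\mathbf{A}\ \mathbf{b}]$ and $s_\lambda([\mathbf{A}\ \mathbf{b}])$ its statistical dimension. Let $\tilde\tau:\Omega\to\mathbb{R}$ be a measurable function with $\tilde\tau(\eta)\ge\tau_\lambda(\eta)$ for all $\eta\in\Omega$ and $s_{\tilde\tau}=\int_\Omega\tilde\tau(\eta)\,d\eta<\infty$,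 and put $p_{\tilde\tau}(\eta)=\tilde\tau(\eta)/s_{\tilde\tau}$. Sample $\eta_1,\dots,\eta_s\in\Omega$ independently from the density $p_{\tilde\tau}$, set $w_j=\sqrt{\frac{p(\eta_j)}{s\,p_{\tilde\tau}(\eta_j)}}$, and let $\mathbf{A}_\eta\in\mathbb{C}^{s\times n}$ be the matrix whose $j$-th row is $w_j\mathbf{z}_{\mathbf{A}}(\eta_j)^*$ and $\mathbf{b}_\eta\in\mathbb{C}^s$ the vector whose $j$-th entry is $w_j\overline{\mathbf{z}_{\mathbf{b}}(\eta_j)}$. Let $0<\epsilon\le1/2$ and $0<\delta<1$. If $$s\ge\frac83\,s_{\tilde\tau}\,\epsilon^{-2}\ln\left(16\,s_\lambda([\mathbf{A}\ \mathbf{b}])/\delta\right),$$ then with probability at least $1-\delta$ the following holds for all $\mathbf{x}\in\mathbb{C}^n$: $$(1-\epsilon)\left(\|\mathbf{A}\mathbf{x}-\mathbf{b}\|^2_{L_2(\Omega,d\mu)}+\lambda\|\mathbf{x}\|_2^2+\lambda\right)\le\|\mathbf{A}_\eta\mathbf{x}-\mathbf{b}_\eta\|_2^2+\lambda\|\mathbf{x}\|_2^2+\lambda\le(1+\epsilon)\left(\|\mathbf{A}\mathbf{x}-\mathbf{b}\|^2_{L_2(\Omega,d\mu)}+\lambda\|\mathbf{x}\|_2^2+\lambda\right).$$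
   Context: $L_2(\Omega,d\mu)$ is the space of complex-valued square-integrable functions with inner product $(f,g)=\int_\Omega\overline{f(\eta)}g(\eta)\,d\mu(\eta)$. A tall quasimatrix with $n$ columns over a Hilbert space $\mathcal{H}$ is an $n$-tuple $\mathbf{A}=[\mathbf{a}_1\cdots\mathbf{a}_n]$ of vectors of $\mathcal{H}$, identified with the linear map $\mathbb{C}^n\to\mathcal{H}$, $\mathbf{A}\mathbf{x}=\sum_j x_j\mathbf{a}_j$; $\mathbf{A}^*$ is its adjoint, so $\mathbf{A}^*\mathbf{A}$ is the Gram matrix with entries $(\mathbf{a}_i,\mathbf{a}_j)_{\mathcal{H}}$. It has full rank if its columns are linearly independent. An element $\mathbf{b}\in\mathcal{H}$ is regarded as a tall quasimatrix with one column. A coordinate representation of a tall quasimatrix $\mathbf{A}$ with $n$ columns over $L_2(\Omega,d\mu)$ is a function $\mathbf{z}:\Omega\to\mathbb{C}^n$ with $\int_\Omega\|\mathbf{z}(\eta)\|_2^2\,d\mu(\eta)<\infty$ and $\mathbf{A}\mathbf{x}=\sum_{i=1}^n x_i\overline{\mathbf{z}(\cdot)_i}$ in $L_2(\Omega,d\mu)$ for all $\mathbf{x}\in\mathbb{C}^n$ (i.e. column $i$ is represented by $\overline{\mathbf{z}(\cdot)_i}$). For a tall quasimatrix $\mathbf{M}$ with $N$ columns over $L_2(\Omega,d\mu)$ with coordinate representation $\mathbf{z}$, where $\mu$ is a probability measure with density $p$, and for $\mathbf{K}=\mathbf{M}^*\mathbf{M}$, the $\lambda$-leverage function of $\mathbf{M}$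 is $\tau_\lambda(\eta)=p(\eta)\,\mathbf{z}(\eta)^*(\mathbf{K}+\lambda\mathbf{I}_N)^{-1}\mathbf{z}(\eta)$, and the statistical dimension is $s_\lambda(\mathbf{M})=\mathrm{Tr}\left((\mathbf{K}+\lambda\mathbf{I}_N)^{-1}\mathbf{K}\right)$. *)

(* Defs.v *)
From HB Require Import structures.
From mathcomp Require Import all_boot all_order all_algebra.
From mathcomp Require Import all_classical all_reals all_analysis.
From mathcomp Require Import complex.

Set Implicit Arguments.
Unset Strict Implicit.
Unset Printing Implicit Defensive.

Import Order.TTheory GRing.Theory Num.Theory.
Import numFieldNormedType.Exports.

Local Open Scope classical_set_scope.
Local Open Scope ring_scope.

(* R^d with its Borel sigma-algebra, as the d-fold product of the Borel
   sigma-algebra of R. *)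
Notation Rspace R d := (d.-tuple (measurableTypeR R)).

Section lebesgue_step.
Context {R : realType} {d : nat}.
Variable m : {sigma_finite_measure set (Rspace R d) -> \bar R}.

Definition cons_pair (x : measurableTypeR R * Rspace R d) : Rspace R d.+1 :=
  [tuple of x.1 :: x.2].

Lemma measurable_cons_pair : measurable_fun setT cons_pair.
Proof. exact: measurable_cons. Qed.

(* A |-> \int m {v | (x, v) in A} dx, i.e. the product of the Lebesgue measure
   of R with m, transported from R x R^d to R^(d+1). *)
Definition lebesgue_step : set (Rspace R d.+1) -> \bar R :=
  pushforward (@lebesgue_measure R \x m)%E cons_pair.

Let measurable_preimage (A : set (Rspace R d.+1)) :
  measurable A -> measurable (cons_pair @^-1` A).
Proof.
by move=> mA; rewrite -[X in measurable X]setTI; exact: measurable_cons_pair.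
Qed.

Let lebesgue_step0 : lebesgue_step set0 = 0%E.
Proof. by rewrite /lebesgue_step /pushforward preimage_set0 measure0. Qed.

Let lebesgue_step_ge0 A : (0 <= lebesgue_step A)%E.
Proof. by rewrite /lebesgue_step /pushforward. Qed.

Let lebesgue_step_sigma_additive : semi_sigma_additive lebesgue_step.
Proof.
move=> F mF tF mUF; rewrite /lebesgue_step /pushforward preimage_bigcup.
apply: measure_semi_sigma_additive.
- by move=> n; exact: measurable_preimage.
- apply/trivIsetP => /= i j _ _ ij; rewrite -preimage_setI.
  by move/trivIsetP : tF => /(_ _ _ _ _ ij) ->//; rewrite preimage_set0.
- by rewrite -preimage_bigcup; exact: measurable_preimage.
Qed.

HB.instance Definition _ := isMeasure.Build _ _ _ lebesgue_step
  lebesgue_step0 lebesgue_step_ge0 lebesgue_step_sigma_additive.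

Let uncons (v : Rspace R d.+1) : measurableTypeR R * Rspace R d :=
  (thead v, [tuple of behead v]).

Let lebesgue_step_sigma_finite : sigma_finite setT lebesgue_step.
Proof.
have /sigma_finiteP[F [FT ndF Foo]] := sigma_finiteT (@lebesgue_measure R).
have /sigma_finiteP[G [GT ndG Goo]] := sigma_finiteT m.
have unconsK (x : measurableTypeR R * Rspace R d) : uncons (cons_pair x) = x.
  by case: x => x v; congr pair; apply/val_inj.
have muncons : measurable_fun setT uncons.
  apply/measurable_fun_pair; first exact: measurable_tnth.
  exact: measurable_behead.
exists (fun i => uncons @^-1` (F i `*` G i)).
  rewrite -preimage_bigcup (_ : \bigcup_i _ = setT) ?preimage_setT//.
  rewrite -setXTT FT GT predeqE => -[x y]; split.
    by move=> [n _ []/= ? ?]; split; exists n.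
  move=> [/= [i _ Fix] [k _ Gky]]; exists (maxn i k) => //; split.
  - by move: x Fix; exact/subsetPset/ndF/leq_maxl.
  - by move: y Gky; exact/subsetPset/ndG/leq_maxr.
move=> i; have [mFi Fioo] := Foo i; have [mGi Gioo] := Goo i; split.
  by rewrite -[X in measurable X]setTI; apply: muncons => //; exact: measurableX.
rewrite /lebesgue_step /pushforward (_ : _ @^-1` _ = F i `*` G i).
  by rewrite product_measure1E// lte_mul_pinfty// ge0_fin_numE.
by rewrite -comp_preimage (_ : uncons \o _ = id)//; exact/funext.
Qed.

HB.instance Definition _ := Measure_isSigmaFinite.Build _ _ _ lebesgue_step
  lebesgue_step_sigma_finite.

End lebesgue_step.

Fixpoint lebesgue_Rd {R : realType} (d : nat) :
    {sigma_finite_measure set (Rspace R d) -> \bar R} :=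
  match d with
  | 0 => [the {sigma_finite_measure set (Rspace R 0) -> \bar R} of
           \d_([tuple] : Rspace R 0)]
  | d'.+1 => [the {sigma_finite_measure set (Rspace R d'.+1) -> \bar R} of
               lebesgue_step (lebesgue_Rd d')]
  end.

Section complex_vectors.
Context {R : realType}.

Definition vnorm2 {n} (x : 'cV[R[i]]_n) : R :=
  Num.sqrt (\sum_i Normc.normc (x i 0) ^+ 2).

Definition mxnorm2 {m n} (M : 'M[R[i]]_(m, n)) : R :=
  sup [set vnorm2 (M *m x) | x in [set x | vnorm2 x <= 1]].

Definition adjmx {m n} (M : 'M[R[i]]_(m, n)) : 'M[R[i]]_(n, m) :=
  map_mx Num.conj M^T.

End complex_vectors.

(* Elements of L_2(D, mu) are represented by complex functions on the ambient
   space; only their values on D matter, and equality in L_2(D, mu) is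
   mu-almost everywhere equality on D. *)
Section L2.
Context {dT : measure_display} {T : measurableType dT} {R : realType}.
Variables (mu : {measure set T -> \bar R}) (D : set T).
Implicit Types f g : T -> R[i].

Definition cmeasurable f : Prop :=
  measurable_fun D (fun t => complex.Re (f t)) /\
  measurable_fun D (fun t => complex.Im (f t)).

Definition cintegral f : R[i] :=
  Complex (\int[mu]_(t in D) complex.Re (f t))
          (\int[mu]_(t in D) complex.Im (f t)).

Definition L2_fun f : Prop :=
  cmeasurable f /\
  (\int[mu]_(t in D) ((Normc.normc (f t)) ^+ 2)%:E < +oo)%E.

Definition L2_eq f g : Prop := {ae mu, forall t, D t -> f t = g t}.

Definition L2_inner f g : R[i] := cintegral (fun t => (f t)^* * g t).

Definition L2_norm f : R := Num.sqrt (complex.Re (L2_inner f f)).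

Definition quasimatrix {n} (A : 'I_n -> T -> R[i]) : Prop :=
  forall j, L2_fun (A j).

Definition qapply {n} (A : 'I_n -> T -> R[i]) (x : 'cV[R[i]]_n) : T -> R[i] :=
  fun t => \sum_j x j 0 * A j t.

Definition gram {n} (A : 'I_n -> T -> R[i]) : 'M[R[i]]_n :=
  \matrix_(i, j) L2_inner (A i) (A j).

Definition full_rank {n} (A : 'I_n -> T -> R[i]) : Prop :=
  forall x : 'cV[R[i]]_n, L2_eq (qapply A x) (fun=> 0) -> x = 0.

Definition coord_rep {n} (A : 'I_n -> T -> R[i]) (z : T -> 'cV[R[i]]_n) : Prop :=
  [/\ forall i, cmeasurable (fun t => z t i 0),
      (\int[mu]_(t in D) ((vnorm2 (z t)) ^+ 2)%:E < +oo)%E &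
      forall x : 'cV[R[i]]_n,
        L2_eq (qapply A x) (fun t => \sum_i x i 0 * (z t i 0)^*)].

(* K + lambda I is Hermitian positive semidefinite, so the quadratic form and
   the trace below are real numbers; complex.Re only changes their type. *)
Definition leverage {n} (p : T -> R) (A : 'I_n -> T -> R[i])
    (z : T -> 'cV[R[i]]_n) (lambda : R) (t : T) : R :=
  p t * complex.Re
    ((adjmx (z t) *m invmx (gram A + (lambda%:C)%C%:M) *m z t) 0 0).

Definition statistical_dim {n} (A : 'I_n -> T -> R[i]) (lambda : R) : R :=
  complex.Re (\tr (invmx (gram A + (lambda%:C)%C%:M) *m gram A)).

End L2.

Definition column_quasimatrix {T : Type} {R : realType} (b : T -> R[i]) :
  'I_1 -> T -> R[i] := fun=> b.

Definition append_column {T : Type} {R : realType} {n} (A : 'I_n -> T -> R[i])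
    (b : T -> R[i]) : 'I_(n + 1) -> T -> R[i] :=
  fun k => match fintype.split k with inl i => A i | inr _ => b end.

(* nu has density q on D with respect to leb; in particular nu vanishes
   outside D. *)
Definition has_density {dT : measure_display} {T : measurableType dT}
    {R : realType} (leb : {measure set T -> \bar R}) (D : set T)
    (nu : set T -> \bar R) (q : T -> R) : Prop :=
  [/\ measurable_fun D q,
      forall t, D t -> 0 <= q t &
      forall B, measurable B ->
        nu B = (\int[leb]_(t in D `&` B) (q t)%:E)%E].

Definition mutually_independent {dT dU : measure_display}
    {T : measurableType dT} {U : measurableType dU} {R : realType}
    {I : finType} (P : probability T R) (X : I -> {RV P >-> U}) : Prop :=
  forall (J : {set I}) (B : I -> set U), (forall i, measurable (B i)) ->
    P [set t | forall i, i \in J -> B i (X i t)] =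
    (\prod_(i in J) P (X i @^-1` B i))%E.

Section sampling.
Context {T : Type} {R : realType}.

Definition sample_weight (s : nat) (p q : T -> R) (t : T) : R :=
  Num.sqrt (p t / (s%:R * q t)).

Definition sampled_mx {s n} (p q : T -> R) (z : T -> 'cV[R[i]]_n)
    (eta : 'I_s -> T) : 'M[R[i]]_(s, n) :=
  \matrix_(j < s) ((sample_weight s p q (eta j))%:C%C *: adjmx (z (eta j))).

Definition sampled_vec {s} (p q : T -> R) (z : T -> R[i])
    (eta : 'I_s -> T) : 'cV[R[i]]_s :=
  \col_(j < s) ((sample_weight s p q (eta j))%:C%C * (z (eta j))^*).

End sampling.

(* Main.v *)
Require Import Defs.
From HB Require Import structures.
From mathcomp Require Import all_boot all_order all_algebra.
From mathcomp Require Import all_classical all_reals all_analysis.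
From mathcomp Require Import complex.
From mathcomp Require Import measurable_realfun spectral sesquilinear ring lra.

Set Implicit Arguments.
Unset Strict Implicit.
Unset Printing Implicit Defensive.

Import Order.TTheory GRing.Theory Num.Theory.
Import numFieldNormedType.Exports.

Local Open Scope classical_set_scope.
Local Open Scope ring_scope.

(** Put h x := (x; -1).  Both members of the inequality are Hermitian forms
    evaluated at h x.  If G is the Gram matrix of [A b] and z = (zA, zb), then
      |Ax - b|^2 + lambda |x|^2 + lambda = h^H (G + lambda) h,
      |A_eta x - b_eta|^2 = h^H (sum_j w_j^2 z(eta_j) z(eta_j)^H) h.
    Choose T with T^H T = (G + lambda)^-1 ([whitener]) and substitute
    h = T^H v.  The claim becomes: the random matrix sum_j y_j y_j^H, where
    y_j := w_j T z(eta_j), is within eps of its mean T G T^H in operator norm.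
    That mean is diag(g / (g + lambda)) for the eigenvalues g of G, so it is at
    most 1 and its trace is the statistical dimension; and |y_j|^2 <= s_tau / s,
    because tau dominates the leverage function p |T z|^2
    ([sampled_vector_le], [sampled_vector_mean]).  What remains is a matrix
    Chernoff bound whose prefactor is the trace of the mean instead of the
    dimension ([matrix_chernoff]).

    The usual proof of such a bound follows tr exp(S) along the partial sums S
    of the centred matrices Z_j := a (y_j y_j^H - K), with K the mean of
    y_j y_j^H, and uses the Golden-Thompson inequality.  Here exp(S) is replaced
    by (1 + S / N)^N with N a large power of two ([compound]).  The inequality
    |tr (AB)^N| <= tr A^N B^N ([golden_thompson_pow]) is then algebraic: it
    follows from Hoelder's inequality for traces of products of N matrices
    ([schatten_holder]), which is an induction on log2 N.  Non-commutativity of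
    1 + S / N and 1 + Z / N costs an error O(1 / N) ([compound_add_le]), and for
    |Z| <= 1/2 one has (1 + Z / N)^N <= 1 + Z + (2/3) Z^2 ([compound_le]).

    A dimension-free prefactor comes from following the potential
    psi(S) := tr ((1 + S / N)^N - 1 - S).  It vanishes at 0, and since N is even
    it is a sum of nonnegative contributions of the eigenvalues of S, so a small
    potential bounds the largest eigenvalue ([qform_le_of_excess]).  The
    upper bound for psi(S + Z_j) is affine in y_j y_j^H, so its expectation is
    obtained by putting K in place of y_j y_j^H ([excess_step]).  Iterating over
    independent samples bounds the expected potential by a multiple of tr (s K),
    the statistical dimension ([expected_potential_le]); Markov's inequality
    and the choice a = +-(3/4) eps / L, where L bounds |y_j|^2, finish the
    proof ([one_sided_chernoff]).  The constant 16 in the logarithm suffices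
    because the statistical dimension is at least 1/2 when the norm of G is at
    least lambda ([statistical_sum_ge]).

    The event in the theorem is an intersection over uncountably many x.  It is
    measurable because it can be tested on vectors with rational coordinates
    ([Re_qform_ge0_rat]). *)

Local Open Scope sesquilinear_scope.
Local Notation Re := complex.Re.
Local Notation Im := complex.Im.

(** * Trace inequalities for products of matrices *)

Section trace_inequality.
Context {C : numClosedFieldType} {n : nat}.
Implicit Types A B X : 'M[C]_n.

Lemma adjM A B : (A * B)^t* = B^t* * A^t*.
Proof. by rewrite trmx_mul map_mxM. Qed.

Lemma adjX A k : (A ^+ k)^t* = A^t* ^+ k.
Proof.
elim: k => [|k IH]; first by rewrite !expr0 trmx1 map_mx1.
by rewrite exprS adjM IH -exprSr.
Qed.

Lemma mxtraceMC A B : \tr (A * B) = \tr (B * A).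
Proof. exact: mxtrace_mulC. Qed.

Lemma mxtraceXC A B k : \tr ((A * B) ^+ k) = \tr ((B * A) ^+ k).
Proof.
case: k => [|k]; first by rewrite !expr0.
have H : (A * B) ^+ k.+1 = A * ((B * A) ^+ k * B).
  elim: k => [|k IH]; first by rewrite expr1 expr0 mul1r.
  by rewrite exprS IH exprS !mulrA.
by rewrite H mxtraceMC -mulrA -exprSr.
Qed.

Lemma mxtrace_mul_adj A B : \tr (A * B^t*) = \sum_i \sum_j A i j * (B i j)^*.
Proof. by apply: eq_bigr => i _; rewrite mxE; apply: eq_bigr => j _; rewrite !mxE. Qed.

Lemma mxtrace_herm_real A : A^t* = A -> \tr A \is Num.real.
Proof.
move=> hA; apply/CrealP; rewrite -[in RHS]hA /mxtrace rmorph_sum /=.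
by apply: eq_bigr => i _; rewrite !mxE.
Qed.

(** Entrywise this is 2 |u v| <= |u|^2 + |v|^2. *)
Lemma mxtrace_cauchy A B :
  `|\tr (A * B)| *+ 2 <= \tr (A * A^t*) + \tr (B * B^t*).
Proof.
have -> : \tr (A * B) = \tr (A * (B^t*)^t*) by rewrite trmxCK.
have -> : \tr (B * B^t*) = \tr (B^t* * (B^t*)^t*) by rewrite trmxCK mxtraceMC.
move: (B^t*) => {}B; rewrite !mxtrace_mul_adj -big_split /=.
apply: (@le_trans _ _ (\sum_i \sum_j (`|A i j| * `|B i j|) *+ 2)).
  have -> : \sum_i \sum_j (`|A i j| * `|B i j|) *+ 2 =
     (\sum_i \sum_j (`|A i j| * `|B i j|)) *+ 2.
    by rewrite -sumrMnl; apply: eq_bigr => i _; exact: sumrMnl.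
  rewrite lerMn2r /=; apply: le_trans (ler_norm_sum _ _ _) _.
  apply: ler_sum => i _; apply: le_trans (ler_norm_sum _ _ _) _.
  by apply: ler_sum => j _; rewrite normrM norm_conjC.
apply: ler_sum => i _; rewrite -big_split /=; apply: ler_sum => j _.
rewrite -!normCK -subr_ge0.
have -> : `|A i j| ^+ 2 + `|B i j| ^+ 2 - (`|A i j| * `|B i j|) *+ 2
   = (`|A i j| - `|B i j|) ^+ 2 by ring.
by rewrite -realEsqr realB // ?normr_real.
Qed.

(** Hoelder's inequality for the trace of a product of 2^(m+1) matrices, all
    with exponent 2^(m+1).  The arithmetic mean of the powers stands in for the
    geometric mean of the Schatten norms, so no roots of matrices occur. *)
Lemma schatten_holder m (s : seq 'M[C]_n) : size s = (2 ^ m.+1)%N ->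
  `|\tr (\prod_(A <- s) A)| *+ 2 ^ m.+1 <= \sum_(A <- s) \tr ((A * A^t*) ^+ (2 ^ m)).
Proof.
elim: m s => [|m IH] s.
  case: s => [|A [|B [|? ?]]] //= _; rewrite !big_cons !big_nil mulr1 addr0 !expr1.
  exact: mxtrace_cauchy.
move=> ss.
(* Multiplying neighbours halves the length.  The price is a bound on
   |AB|^(2^(m+1)) in the Schatten norm, which the induction hypothesis gives
   for the alternating list B B^H, A^H A, B B^H, ... of 2^(m+1) factors. *)
have pairs k (r : seq 'M[C]_n) : size r = k.*2 -> exists t : seq 'M[C]_n,
    [/\ size t = k, \prod_(A <- r) A = \prod_(A <- t) A &
     (\sum_(A <- t) \tr ((A * A^t*) ^+ (2 ^ m))) *+ 2 <=
       \sum_(A <- r) \tr ((A * A^t*) ^+ (2 ^ m.+1))].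
  elim: k r => [|k IHk] r.
    by move/size0nil => ->; exists [::]; rewrite !big_nil mul0rn.
  case: r => [|A [|B r]] //; rewrite doubleS /= => -[/IHk [t [st prodt sumt]]].
  exists (A * B :: t); split; first by rewrite /= st.
    by rewrite !big_cons prodt mulrA.
  rewrite !big_cons [in X in X <= _]mulrnDl [leRHS]addrA lerD {sumt}//.
  rewrite adjM -mulrA (mulrA B) (mxtraceXC A) -mulrA.
  pose u := flatten (nseq (2 ^ m) [:: B * B^t*; A^t* * A]).
  have su : size u = (2 ^ m.+1)%N.
    by rewrite size_flatten /shape map_nseq sumn_nseq /= expnS.
  have := IH u su.
  have -> : \prod_(X <- u) X = (B * B^t* * (A^t* * A)) ^+ (2 ^ m).
    rewrite /u; elim: (2 ^ m)%N => [|l IHl]; first by rewrite big_nil expr0.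
    by rewrite /= !big_cons IHl exprS mulrA.
  have -> : \sum_(X <- u) \tr ((X * X^t*) ^+ (2 ^ m)) =
     (\tr ((A * A^t*) ^+ (2 ^ m.+1)) + \tr ((B * B^t*) ^+ (2 ^ m.+1))) *+ 2 ^ m.
    rewrite expnS (mxtraceXC A) !exprM /u.
    elim: {1 5}(2 ^ m)%N => [|l IHl]; first by rewrite big_nil mulr0n.
    rewrite /= !big_cons IHl !adjM !trmxCK mulrS -!expr2 addrA; congr (_ + _).
    exact: addrC.
  rewrite [in X in X <= _]expnS mulrnA lerMn2r expn_eq0 /=; apply: le_trans.
  rewrite lerMn2r /=.
  apply: real_ler_norm.
  have -> : \tr ((B * B^t* * (A^t* * A)) ^+ (2 ^ m))
     = \tr (((A * B) * (A * B)^t*) ^+ (2 ^ m)).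
    by rewrite adjM -[in RHS]mulrA (mulrA B) (mxtraceXC A) -!mulrA.
  apply: mxtrace_herm_real; rewrite adjX; congr (_ ^+ _).
  by rewrite !adjM !trmxCK.
have [|t [st prodt]] := pairs (2 ^ m.+1)%N s; first by rewrite ss -mul2n -expnS.
move=> /(le_trans _); apply.
by rewrite prodt [in leLHS]expnSr mulrnA lerMn2r /=; exact: IH.
Qed.

Lemma mxtraceX_le X m :
  `|\tr (X ^+ (2 ^ m.+1))| <= \tr ((X * X^t*) ^+ (2 ^ m)).
Proof.
have := @schatten_holder m (nseq (2 ^ m.+1) X) (size_nseq _ _).
rewrite !big_nseq GRing.iter_addr_0 GRing.iter_mulr_1 lerMn2r expn_eq0 /=; exact.
Qed.

(** With A = e^(S/N), B = e^(Z/N) and N tending to infinity this becomes the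
    Golden-Thompson inequality; keeping N finite avoids matrix exponentials.
    Each step of the induction passes from X = AB to X X^H, which is A^2 B^2 up
    to a cyclic permutation, by [mxtraceX_le]. *)
Lemma golden_thompson_pow A B m : A^t* = A -> B^t* = B ->
  `|\tr ((A * B) ^+ (2 ^ m.+1))| <= \tr (A ^+ (2 ^ m.+1) * B ^+ (2 ^ m.+1)).
Proof.
elim: m A B => [|m IH] A B hA hB.
  apply: le_trans (mxtraceX_le _ _) _.
  by rewrite expr1 adjM hA hB mulrA mxtraceMC !expr2 !mulrA.
have sq k : \tr ((A * B * (A * B)^t*) ^+ k) = \tr ((A ^+ 2 * B ^+ 2) ^+ k).
  by rewrite adjM hA hB -mulrA mxtraceXC !expr2 -!mulrA [in LHS]mulrA mxtraceXC !mulrA.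
apply: le_trans (mxtraceX_le _ _) _.
rewrite sq; have := IH (A ^+ 2) (B ^+ 2).
rewrite !adjX hA hB -!exprM -!expnS => /(_ erefl erefl); apply: le_trans.
apply: real_ler_norm.
rewrite -sq; apply: mxtrace_herm_real; rewrite adjX; congr (_ ^+ _).
by rewrite !adjM !trmxCK.
Qed.

End trace_inequality.

(** * Hermitian forms and functions of Hermitian matrices *)

Section psd.
Context {C : numClosedFieldType} {n : nat}.
Implicit Types (A B H : 'M[C]_n) (v : 'cV[C]_n).

Definition qform A v : C := (v^t* *m A *m v) 0 0.
Definition psd A : Prop := forall v, 0 <= qform A v.

Lemma qformD A B v : qform (A + B) v = qform A v + qform B v.
Proof. by rewrite /qform mulmxDr mulmxDl mxE. Qed.
Lemma qformN A v : qform (- A) v = - qform A v.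
Proof. by rewrite /qform mulmxN mulNmx mxE. Qed.
Lemma qformB A B v : qform (A - B) v = qform A v - qform B v.
Proof. by rewrite qformD qformN. Qed.
Lemma qformZ a A v : qform (a *: A) v = a * qform A v.
Proof. by rewrite /qform -scalemxAr -scalemxAl mxE. Qed.
Lemma qform_sum I (r : seq I) (F : I -> 'M[C]_n) v :
  qform (\sum_(i <- r) F i) v = \sum_(i <- r) qform (F i) v.
Proof.
elim/big_rec2: _ => [|i x A _ <-]; last by rewrite qformD.
by rewrite /qform mulmx0 mul0mx mxE.
Qed.

Lemma qform1 v : qform 1 v = \sum_i `|v i 0| ^+ 2.
Proof.
by rewrite /qform mulmx1 mxE; apply: eq_bigr => i _; rewrite !mxE mulrC normCK.
Qed.

Lemma qform1_ge0 v : 0 <= qform 1 v.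
Proof. by rewrite qform1 sumr_ge0 // => i _; rewrite exprn_ge0. Qed.

Lemma qform_outer (y : 'cV[C]_n) v :
  qform (y *m y^t*) v = `|(y^t* *m v) 0 0| ^+ 2.
Proof.
rewrite /qform mulmxA -mulmxA mxE big_ord1 mulrC normCK; congr (_ * _).
rewrite !mxE rmorph_sum; apply: eq_bigr => i _; rewrite !mxE rmorphM mulrC.
by congr (_ * _); exact/esym/conjCK.
Qed.

(** The trace of H B H is the sum of the values of the form B at the columns
    of H. *)
Lemma mxtrace_sq_psd_ge0 H B : H^t* = H -> psd B -> 0 <= \tr (H ^+ 2 * B).
Proof.
move=> hH pB; rewrite expr2 -mulrA mxtraceMC.
apply: sumr_ge0 => i _.
suff -> : (H * B * H) i i = qform B (col i H) by exact: pB.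
have hHij k l : (H k l)^* = H l k by rewrite -[in RHS]hH !mxE.
rewrite /qform !mxE; apply: eq_bigr => j _; rewrite !mxE.
congr (_ * _); apply: eq_bigr => k _; by rewrite !mxE -(hHij k i).
Qed.

Section diagonalized.
Variable U : 'M[C]_n.
Hypothesis UU : U \is unitarymx.

(** For a unitary U this is the matrix with eigenvalues e in the orthonormal
    basis given by the rows of U, so that algebra on such matrices is algebra
    on the families e. *)
Definition udiag (e : 'I_n -> C) : 'M[C]_n :=
  U^t* *m diag_mx (\row_i e i) *m U.

Lemma udiagM e f : udiag e * udiag f = udiag (fun i => e i * f i).
Proof.
rewrite /udiag -mulmxE !mulmxA (mulmxtVK _ UU); congr (_ *m _).
rewrite -!mulmxA; congr (_ *m _).
apply/matrixP => i j; rewrite mul_diag_mx !mxE.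
by case: eqP => [->|_]; rewrite ?mulr0n ?mulr1n ?mulr0.
Qed.

Lemma udiagD e f : udiag e + udiag f = udiag (fun i => e i + f i).
Proof.
rewrite /udiag -mulmxDl -mulmxDr; congr (_ *m _ *m _).
by apply/matrixP => i j; rewrite !mxE mulrnDl.
Qed.

Lemma udiagB e f : udiag e - udiag f = udiag (fun i => e i - f i).
Proof.
rewrite /udiag -mulmxBl -mulmxBr; congr (_ *m _ *m _).
by apply/matrixP => i j; rewrite !mxE mulrnBl.
Qed.

Lemma udiagZ a e : a *: udiag e = udiag (fun i => a * e i).
Proof.
rewrite /udiag scalemxAl scalemxAr; congr (_ *m _ *m _).
by apply/matrixP => i j; rewrite !mxE mulrnAr.
Qed.

Lemma udiag1 : udiag (fun=> 1) = 1.
Proof.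
rewrite /udiag (_ : diag_mx _ = 1%:M); last first.
  by apply/matrixP => i j; rewrite !mxE.
by rewrite mulmx1; apply: mulmx1C; exact/unitarymxP.
Qed.

Lemma udiagX e k : udiag e ^+ k = udiag (fun i => e i ^+ k).
Proof.
elim: k => [|k IH]; first by rewrite expr0 -udiag1.
by rewrite exprS IH udiagM; congr udiag; apply/funext => i; rewrite exprS.
Qed.

Lemma qform_udiag e v : qform (udiag e) v = \sum_i e i * `|(U *m v) i 0| ^+ 2.
Proof.
have -> : qform (udiag e) v =
    ((U *m v)^t* *m (diag_mx (\row_i e i) *m (U *m v))) 0 0.
  by rewrite /qform /udiag trmx_mul map_mxM !mulmxA.
rewrite mxE; apply: eq_bigr => i _.
by rewrite mul_diag_mx !mxE normCK mulrCA (mulrC (_ ^*)).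
Qed.

Lemma qform_udiag_le e (y : C) v : (forall i, e i <= y) ->
  qform (udiag e) v <= y * qform 1 v.
Proof.
move=> ey; rewrite -[X in _ * qform X v]udiag1 !qform_udiag mulr_sumr.
by apply: ler_sum => i _; rewrite mul1r ler_wpM2r ?exprn_ge0.
Qed.

Lemma psd_udiag e : (forall i, 0 <= e i) -> psd (udiag e).
Proof.
by move=> e0 v; rewrite qform_udiag sumr_ge0// => i _; rewrite mulr_ge0// exprn_ge0.
Qed.

Lemma mxtrace_udiag_mul e B :
  \tr (udiag e * B) = \sum_i e i * qform B (col i (U^t*)).
Proof.
rewrite /udiag -mulmxE -!mulmxA mxtrace_mulC -mulmxA.
apply: eq_bigr => i _; rewrite mul_diag_mx mxE mxE; congr (_ * _).
rewrite /qform !mxE.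
apply: eq_bigr => j _; rewrite !mxE; congr (_ * _).
by apply: eq_bigr => k _; rewrite !mxE conjCK.
Qed.

Lemma qform_udiag_col e i : qform (udiag e) (col i (U^t*)) = e i.
Proof.
rewrite qform_udiag.
have -> : U *m col i (U^t*) = \col_k (k == i)%:R.
  by rewrite colE mulmxA (unitarymxP UU) mul1mx;
    apply/matrixP => k l; rewrite !mxE ord1 eqxx andbT.
rewrite (bigD1 i)//= big1 ?addr0 => [|k /negPf ki].
  by rewrite !mxE eqxx normr1 expr1n mulr1.
by rewrite !mxE ki normr0 expr0n mulr0.
Qed.

Lemma psd_udiag_mul_ge0 e B : (forall i, 0 <= e i) -> psd B ->
  0 <= \tr (udiag e * B).
Proof.
move=> e0 pB; rewrite mxtrace_udiag_mul; apply: sumr_ge0 => i _.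
by rewrite mulr_ge0// pB.
Qed.

Lemma mxtrace_udiag e : \tr (udiag e) = \sum_i e i.
Proof.
rewrite -[udiag e]mulr1 mxtrace_udiag_mul; apply: eq_bigr => i _.
by rewrite -[X in qform X]udiag1 qform_udiag_col mulr1.
Qed.

End diagonalized.

Lemma herm_spectral A : A^t* = A ->
  exists U (e : 'I_n -> C), [/\ U \is unitarymx, forall i, e i \is Num.real
    & A = udiag U e].
Proof.
move=> hA; exists (spectralmx A), (fun i => spectral_diag A 0 i).
have hermA : A \is hermsymmx.
  by apply/is_hermitianmxP; rewrite expr0 scale1r; exact/esym.
split; first exact: spectral_unitarymx.
  by move=> i; have /mxOverP := hermitian_spectral_diag_real hermA; exact.
rewrite {1}(orthomx_spectralP (hermitian_normalmx hermA)).
rewrite invmx_unitary ?spectral_unitarymx// /udiag; congr (_ *m _ *m _).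
by apply/matrixP => i j; rewrite !mxE.
Qed.

End psd.

(** * Compound powers in place of the exponential *)

Section scalar.
Context {R : realFieldType}.
Implicit Types x a : R.

Lemma bernoulli_ge a k : -1 <= a -> 1 + k%:R * a <= (1 + a) ^+ k.
Proof.
move=> a1; elim: k => [|k IH]; first by rewrite mul0r addr0 expr0.
have a0 : 0 <= 1 + a by lra.
rewrite exprS; apply: le_trans (ler_wpM2l a0 IH).
rewrite -natr1; have : 0 <= k%:R * a ^+ 2 :> R by rewrite mulr_ge0 ?sqr_ge0.
nra.
Qed.

(** Where the base 1 + x / N is at least 0 this is Bernoulli's inequality.
    For smaller x the left-hand side is negative and an even power is not. *)
Lemma compound_ge x N : (0 < N)%N -> ~~ odd N -> 1 + x <= (1 + N%:R^-1 * x) ^+ N.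
Proof.
move=> N0 evN; have N0' : 0 < N%:R :> R by rewrite ltr0n.
have [xN|xN] := leP (- N%:R) x.
  have := @bernoulli_ge (N%:R^-1 * x) N.
  by rewrite mulrA divff ?gt_eqF// mul1r; apply; rewrite mulrC ler_pdivlMr// mulN1r.
apply: (@le_trans _ _ 0).
  by have : 1 <= N%:R :> R by [rewrite ler1n]; lra.
by rewrite exprn_even_ge0.
Qed.

(** This is the source of the constant 8/3 in the sample size: it limits the
    second moment term of one step to (2/3) x^2. *)
Lemma compound_le x N : (0 < N)%N -> `|x| <= 1 / 2 ->
  (1 + N%:R^-1 * x) ^+ N <= 1 + x + 2 / 3 * x ^+ 2.
Proof.
move=> N0; have N0' : 0 < N%:R :> R by rewrite ltr0n.
rewrite ler_norml => /andP[x1 x2].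
set a := N%:R^-1 * x; have Na : N%:R * a = x.
  by rewrite /a mulrA divff ?gt_eqF// mul1r.
have a1 : 0 <= 1 + a.
  suff : -1 <= a by lra.
  rewrite -(ler_pM2l N0') Na; have : 1 <= N%:R :> R by rewrite ler1n.
  lra.
(* The quadratic bound holds along all powers k <= N, not only at k = N.
   The induction step leaves a remainder that is nonnegative because
   2 k a <= 1. *)
suff H k : (k <= N)%N ->
    (1 + a) ^+ k <= 1 + k%:R * a + 2 / 3 * (k%:R * a) ^+ 2.
  by have := H N (leqnn _); rewrite Na.
elim: k => [|k IH] kN; first by rewrite expr0; nra.
rewrite exprS; apply: (le_trans (ler_wpM2l a1 (IH (ltnW kN)))).
have ka : k%:R * a <= 1 / 2.
  have [a0|a0] := leP 0 a.
    apply: (@le_trans _ _ (N%:R * a)); last by rewrite Na.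
    by rewrite ler_wpM2r// ler_nat ltnW.
  apply: (@le_trans _ _ 0); last by lra.
  by rewrite mulr_ge0_le0 // ltW.
have k0 : 0 <= k%:R :> R by [].
rewrite -natr1 -subr_ge0.
set q : R := k%:R in ka k0 *.
rewrite (_ : _ - _ = a ^+ 2 * (q / 3 * (1 - 2 * (q * a)) + 2 / 3)); last by field.
apply: mulr_ge0; first exact: sqr_ge0.
apply: addr_ge0; last lra.
apply: mulr_ge0; lra.
Qed.

Lemma compound_sub_mono x y N : (0 < N)%N -> 0 <= y -> y <= x ->
  (1 + N%:R^-1 * y) ^+ N - 1 - y <= (1 + N%:R^-1 * x) ^+ N - 1 - x.
Proof.
move=> N0 y0 yx; have N0' : 0 < N%:R :> R by rewrite ltr0n.
set a := 1 + _ * y; pose b := N%:R^-1 * (x - y).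
have -> : 1 + N%:R^-1 * x = a + b by rewrite /a /b; ring.
have xy : x - y = N%:R * b by rewrite /b mulrA divff ?gt_eqF// mul1r.
have a1 : 1 <= a by rewrite /a lerDl mulr_ge0// invr_ge0 ltW.
have b0 : 0 <= b by rewrite /b mulr_ge0 ?invr_ge0 ?subr_ge0// ltW.
(* Raising the base a >= 1 by b raises the k-th power by at least k b. *)
suff H k : a ^+ k + k%:R * b <= (a + b) ^+ k by have := H N; rewrite -xy; lra.
elim: k => [|k IH]; first by rewrite !expr0 mul0r addr0.
have ab0 : 0 <= a + b by lra.
rewrite [in leRHS]exprS; apply: le_trans (ler_wpM2l ab0 IH).
have ak : 1 <= a ^+ k by rewrite exprn_ege1.
have kb : 0 <= k%:R * b by rewrite mulr_ge0.
rewrite exprS -natr1; nra.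
Qed.

End scalar.

Section norm1.
Context {C : numClosedFieldType} {n : nat}.
Implicit Types A B P Q : 'M[C]_n.

(** An auxiliary submultiplicative norm.  It only enters error terms that
    vanish as N grows, so its dependence on the dimension is harmless. *)
Definition norm1 A : C := \sum_i \sum_j `|A i j|.

Lemma norm1_ge0 A : 0 <= norm1 A.
Proof. by apply: sumr_ge0 => i _; apply: sumr_ge0. Qed.

Lemma norm1D A B : norm1 (A + B) <= norm1 A + norm1 B.
Proof.
rewrite /norm1 -big_split; apply: ler_sum => i _; rewrite -big_split.
by apply: ler_sum => j _; rewrite mxE ler_normD.
Qed.

Lemma norm1N A : norm1 (- A) = norm1 A.
Proof. by apply: eq_bigr => i _; apply: eq_bigr => j _; rewrite mxE normrN. Qed.

Lemma norm1Z a A : norm1 (a *: A) = `|a| * norm1 A.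
Proof.
rewrite /norm1 mulr_sumr; apply: eq_bigr => i _; rewrite mulr_sumr.
by apply: eq_bigr => j _; rewrite mxE normrM.
Qed.

Lemma norm1M A B : norm1 (A * B) <= norm1 A * norm1 B.
Proof.
apply: (@le_trans _ _ (\sum_i \sum_j \sum_k `|A i k| * `|B k j|)).
  apply: ler_sum => i _; apply: ler_sum => j _; rewrite mxE.
  by apply: le_trans (ler_norm_sum _ _ _) _; apply: ler_sum => k _; rewrite normrM.
rewrite /norm1 mulr_suml; apply: ler_sum => i _.
rewrite exchange_big mulr_suml /=; apply: ler_sum => k _.
rewrite -mulr_sumr ler_wpM2l// [leRHS](bigD1 k)//= lerDl.
by apply: sumr_ge0 => l _; apply: sumr_ge0.
Qed.

Lemma norm_mxtrace A : `|\tr A| <= norm1 A.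
Proof.
apply: le_trans (ler_norm_sum _ _ _) _; apply: ler_sum => i _.
by rewrite (bigD1 i)//= lerDl sumr_ge0.
Qed.

Lemma norm1_mul_near1 P A a : norm1 (P - 1) <= a ->
  norm1 (P * A) <= (1 + a) * norm1 A.
Proof.
move=> Pa; have -> : P * A = A + (P - 1) * A by rewrite mulrBl mul1r addrC subrK.
apply: le_trans (norm1D _ _) _; rewrite [leRHS]mulrDl mul1r lerD2l.
by apply: le_trans (norm1M _ _) _; rewrite ler_wpM2r ?norm1_ge0.
Qed.

Lemma norm1_mulX_near1 Q A a k : norm1 (Q - 1) <= a ->
  norm1 (A * Q ^+ k) <= (1 + a) ^+ k * norm1 A.
Proof.
move=> Qa; have a0 : 0 <= a by apply: le_trans Qa; exact: norm1_ge0.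
elim: k => [|k IH]; first by rewrite !expr0 mul1r mulr1.
have -> : A * Q ^+ k.+1 = A * Q ^+ k + A * Q ^+ k * (Q - 1).
  by rewrite mulrBr mulr1 -mulrA -exprSr addrC subrK.
apply: le_trans (norm1D _ _) _; rewrite exprS -[leRHS]mulrA [leRHS]mulrDl mul1r lerD//.
apply: le_trans (norm1M _ _) _; rewrite mulrC.
by rewrite ler_pM ?norm1_ge0.
Qed.

(** Telescoping P^k - Q^k = sum_j P^j (P - Q) Q^(k-1-j). *)
Lemma norm1_subX P Q a d k : norm1 (P - 1) <= a -> norm1 (Q - 1) <= a ->
  norm1 (P - Q) <= d ->
  norm1 (P ^+ k - Q ^+ k) <= k%:R * (1 + a) ^+ k * d.
Proof.
move=> Pa Qa PQ; have a0 : 0 <= a by apply: le_trans Qa; exact: norm1_ge0.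
have d0 : 0 <= d by apply: le_trans PQ; exact: norm1_ge0.
have a1 : 1 <= 1 + a by rewrite lerDl.
elim: k => [|k IH].
  by rewrite !expr0 subrr !mul0r /norm1 big1// => i _; rewrite big1// => j _;
    rewrite mxE normr0.
have -> : P ^+ k.+1 - Q ^+ k.+1 = P * (P ^+ k - Q ^+ k) + (P - Q) * Q ^+ k.
  by rewrite mulrBl mulrBr -!exprS addrA subrK.
apply: le_trans (norm1D _ _) _; rewrite -natr1 -[leRHS]mulrA [leRHS]mulrDl mul1r mulrA lerD//.
  apply: le_trans (norm1_mul_near1 _ Pa) _; rewrite exprS.
  by rewrite (mulrCA k%:R) -!mulrA ler_wpM2l ?addr_ge0// mulrA.
apply: le_trans (norm1_mulX_near1 _ _ Qa) _.
apply: ler_pM => //; rewrite ?exprn_ge0 ?addr_ge0 ?norm1_ge0//.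
by rewrite ler_weXn2l.
Qed.

End norm1.

Section compound_def.
Context {C : numClosedFieldType} {n : nat}.
Implicit Types S : 'M[C]_n.

(** The N-fold compounding of S, which tends to exp(S) as N grows. *)
Definition compound N S : 'M[C]_n := (1 + N%:R^-1 *: S) ^+ N.

(** The part of [compound N S] beyond its linearization.  It vanishes at 0 and,
    for even N, every eigenvalue contributes a nonnegative amount to its trace.
    A potential built on [compound] alone would start at the dimension n. *)
Definition excess N S : 'M[C]_n := compound N S - 1 - S.

Lemma affine_herm N S : S^t* = S -> (1 + N%:R^-1 *: S)^t* = 1 + N%:R^-1 *: S.
Proof.
move=> hS; apply/matrixP => i j; rewrite -{2}hS !mxE rmorphD rmorphM /= conjC_nat.
by rewrite fmorphV /= !conjC_nat eq_sym.
Qed.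

Lemma compound_herm N S : S^t* = S -> (compound N S)^t* = compound N S.
Proof. by move=> hS; rewrite adjX affine_herm. Qed.

Lemma compound_udiag N (U : 'M[C]_n) e : U \is unitarymx ->
  compound N (udiag U e) = udiag U (fun i => (1 + N%:R^-1 * e i) ^+ N).
Proof.
by move=> UU; rewrite /compound udiagZ -(udiag1 UU) udiagD udiagX.
Qed.

Lemma excess_udiag N (U : 'M[C]_n) e : U \is unitarymx ->
  excess N (udiag U e) = udiag U (fun i => (1 + N%:R^-1 * e i) ^+ N - 1 - e i).
Proof.
move=> UU; rewrite /excess (compound_udiag N e UU) -[X in _ - X - _](udiag1 UU).
by rewrite !udiagB.
Qed.

Lemma affine_mul (a : C) S (T : 'M[C]_n) :
  ((1 : 'M[C]_n) + a *: S) * ((1 : 'M[C]_n) + a *: T) =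
  (1 : 'M[C]_n) + a *: (S + T) + a *: (a *: (S * T : 'M[C]_n)).
Proof.
rewrite mulrDr mulr1 mulrDl mul1r -!mulmxE -scalemxAl -scalemxAr scalerDr.
by rewrite !addrA.
Qed.

End compound_def.

Section compound.
Context {R : rcfType} {n : nat}.
Local Notation C := R[i].
Implicit Types (S Z M B : 'M[C]_n).

Lemma herm_spectralR S : S^t* = S ->
  exists U (e : 'I_n -> R), U \is unitarymx /\ S = udiag U (fun i => (e i)%:C%C).
Proof.
move=> /herm_spectral[U [e [UU re ->]]]; exists U, (fun i => complex.Re (e i)).
split; first exact: UU.
congr (udiag U _); apply/funext => i; apply/esym; exact: RRe_real.
Qed.

Lemma real_complex_compound N (x : R) :
  (1 + N%:R^-1 * x%:C%C) ^+ N = ((1 + N%:R^-1 * x) ^+ N)%:C%C :> C.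
Proof. by rewrite rmorphXn rmorphD rmorphM /= fmorphV /= rmorph_nat. Qed.

Lemma real_complex_excess N (x : R) :
  (1 + N%:R^-1 * x%:C%C) ^+ N - 1 - x%:C%C = ((1 + N%:R^-1 * x) ^+ N - 1 - x)%:C%C :> C.
Proof. by rewrite real_complex_compound !rmorphB. Qed.

Lemma excess_mul_psd_ge0 N S B : (0 < N)%N -> ~~ odd N -> S^t* = S -> psd B ->
  0 <= \tr (excess N S * B).
Proof.
move=> N0 evN /herm_spectralR[U [e [UU ->]]] pB; rewrite excess_udiag//.
apply: psd_udiag_mul_ge0 => // i.
by rewrite real_complex_excess ler0c -addrA -opprD subr_ge0 compound_ge.
Qed.

Lemma psd1 : psd (1 : 'M[C]_n). Proof. exact: qform1_ge0. Qed.

(** The trace is a sum of nonnegative terms, one for each eigenvalue, and the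
    term of an eigenvalue above y is at least the excess of y. *)
Lemma qform_le_of_excess N S (y : R) : (0 < N)%N -> ~~ odd N -> S^t* = S -> 0 <= y ->
  \tr (excess N S) < ((1 + N%:R^-1 * y) ^+ N - 1 - y)%:C%C ->
  forall v, qform S v <= y%:C%C * qform 1 v.
Proof.
move=> N0 evN /herm_spectralR[U [e [UU ->]]] y0.
rewrite excess_udiag// mxtrace_udiag//.
under eq_bigr do rewrite real_complex_excess.
rewrite -rmorph_sum ltcR => small.
have N0' : 0 < N%:R :> R by rewrite ltr0n.
have ey i : e i <= y.
  rewrite leNgt; apply/negP => ye; move: small; apply/negP; rewrite -leNgt.
  rewrite (bigD1 i)//= -[leLHS]addr0 lerD//; last first.
    by apply: sumr_ge0 => j _; rewrite -addrA -opprD subr_ge0 compound_ge.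
  exact: compound_sub_mono (ltW ye).
by move=> v; apply: qform_udiag_le => // i; rewrite lecR.
Qed.

Lemma compound_le_quadratic N Z : (0 < N)%N -> Z^t* = Z ->
  (forall v, `|qform Z v| <= 1 / 2 * qform 1 v) ->
  psd (1 + Z + (2 / 3) *: Z ^+ 2 - compound N Z).
Proof.
move=> N0 /herm_spectralR[U [e [UU ->]]] Z12; rewrite compound_udiag//.
rewrite (udiagX UU) -[X in X + _ + _ - _](udiag1 UU) udiagZ !udiagD udiagB.
apply: psd_udiag => // i; rewrite subr_ge0 real_complex_compound.
have := Z12 (col i (U^t*)); rewrite qform_udiag_col//.
rewrite -[X in qform X _](udiag1 UU) qform_udiag_col//.
rewrite mulr1 => ei.
have ei' : `|e i| <= 1 / 2.
  by move: ei; rewrite normc_def /= expr0n addr0 sqrtr_sqr -lecR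
    rmorphM /= fmorphV rmorph1 rmorph_nat.
have := compound_le N0 ei'; rewrite -lecR !rmorphD /= !rmorphM !rmorphXn /= fmorphV /=.
by rewrite !rmorph1 !rmorph_nat.
Qed.

(** For a fixed c this is O(1 / N); see [trotter_error_le]. *)
Definition trotter_error (N : nat) (c : R) : R :=
  N%:R * (1 + N%:R^-1 * (2 * c + c ^+ 2)) ^+ N * (N%:R^-1 * (N%:R^-1 * c ^+ 2)).

(** The analogue of tr exp(S + Z) <= tr exp(S) exp(Z), followed by the
    quadratic bound on the second factor. *)
Lemma compound_add_le m S Z (c : R) : let N := (2 ^ m.+1)%N in
  S^t* = S -> Z^t* = Z -> norm1 S <= c%:C%C -> norm1 Z <= c%:C%C ->
  (forall v, `|qform Z v| <= 1 / 2 * qform 1 v) ->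
  \tr (compound N (S + Z)) <=
  \tr (compound N S * (1 + Z + (2 / 3) *: Z ^+ 2)) + (trotter_error N c)%:C%C.
Proof.
move=> N hS hZ Sc Zc Z12.
have N0 : (0 < N)%N by rewrite expn_gt0.
have c0 : 0 <= c by rewrite -lecR; apply: le_trans Sc; exact: norm1_ge0.
have hSZ : (S + Z)^t* = S + Z by rewrite linearD /= map_mxD hS hZ.
apply: le_trans (real_ler_norm _) _.
  by apply: mxtrace_herm_real; exact: compound_herm.
(* P and A * B differ by S Z / N^2 only; the N-th powers then differ by
   O(1 / N). *)
pose P : 'M[C]_n := 1 + N%:R^-1 *: (S + Z).
pose A : 'M[C]_n := 1 + N%:R^-1 *: S.
pose B : 'M[C]_n := 1 + N%:R^-1 *: Z.
have hA : A^t* = A by exact: affine_herm.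
have hB : B^t* = B by exact: affine_herm.
have -> : \tr (compound N (S + Z)) = \tr ((A * B) ^+ N) + \tr (P ^+ N - (A * B) ^+ N).
  by rewrite linearB [RHS]addrC subrK.
apply: le_trans (ler_normD _ _) _; apply: lerD.
  apply: le_trans (golden_thompson_pow _ hA hB) _.
  rewrite -subr_ge0 -linearB /= -mulrBr.
  have -> : compound N S = (A ^+ (2 ^ m)) ^+ 2 by rewrite -exprM -expnSr.
  apply: mxtrace_sq_psd_ge0; first by rewrite adjX hA.
  exact: compound_le_quadratic.
apply: le_trans (norm_mxtrace _) _.
pose d : C := (N%:R^-1 * (N%:R^-1 * c ^+ 2))%:C%C.
pose a : C := (N%:R^-1 * (2 * c + c ^+ 2))%:C%C.
have N1 : `|(N%:R^-1 : C)| = N%:R^-1 by rewrite ger0_norm ?invr_ge0.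
have Ni0 : 0 <= (N%:R^-1 : C) by rewrite invr_ge0.
have Ni1 : (N%:R^-1 : C) <= 1 by rewrite invf_le1 ?ltr0n// ler1n.
have SZc : norm1 (S * Z) <= c%:C%C ^+ 2.
  by apply: le_trans (norm1M _ _) _; rewrite expr2 ler_pM ?norm1_ge0.
have aE : a = N%:R^-1 * (c%:C%C + c%:C%C + c%:C%C ^+ 2).
  by rewrite /a rmorphM fmorphV rmorph_nat rmorphD rmorphM rmorphXn rmorph_nat mulr_natl mulr2n.
have dE : d = N%:R^-1 * (N%:R^-1 * c%:C%C ^+ 2).
  by rewrite /d rmorphM rmorphM rmorphXn fmorphV rmorph_nat.
have ABE : A * B = P + N%:R^-1 *: (N%:R^-1 *: (S * Z)) by exact: affine_mul.
have c0' : 0 <= c%:C%C :> C by rewrite ler0c.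
have SZD : norm1 (S + Z) <= c%:C%C + c%:C%C.
  by apply: le_trans (norm1D _ _) _; exact: lerD.
have Pa : norm1 (P - 1) <= a.
  rewrite /P addrAC subrr add0r norm1Z N1 aE ler_wpM2l//.
  by rewrite -[leLHS]addr0 lerD// exprn_ge0.
have Qa : norm1 (A * B - 1) <= a.
  rewrite ABE /P addrAC (addrAC 1) subrr add0r -scalerDr norm1Z N1 aE ler_wpM2l//.
  apply: le_trans (norm1D _ _) _; apply: lerD => //.
  by rewrite norm1Z N1 -[leRHS]mul1r ler_pM ?norm1_ge0.
have PQ : norm1 (P - A * B) <= d.
  rewrite ABE opprD addrA subrr add0r norm1N !norm1Z N1 dE.
  by rewrite !ler_wpM2l.
apply: le_trans (norm1_subX N Pa Qa PQ) _.
by rewrite /trotter_error rmorphM rmorphM rmorphXn rmorphD rmorph1 rmorph_nat.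
Qed.

End compound.

(** * One step of the potential argument *)

Section rank_one.
Context {C : numClosedFieldType} {n : nat}.
Implicit Types (A Q : 'M[C]_n) (y v : 'cV[C]_n).

Lemma scalemxAl_ring a A Q : a *: A * Q = a *: (A * Q).
Proof. by rewrite -mulmxE scalemxAl. Qed.
Lemma scalemxAr_ring a A Q : A * (a *: Q) = a *: (A * Q).
Proof. by rewrite -mulmxE scalemxAr. Qed.
Lemma mxtraceB A Q : \tr (A - Q) = \tr A - \tr Q.
Proof. exact: linearB. Qed.

Definition outer y : 'M[C]_n := y *m y^t*.

Lemma qform1E y : y^t* *m y = (qform 1 y)%:M.
Proof. by rewrite /qform mulmx1 [LHS]mx11_scalar. Qed.

Lemma outer_sq y : outer y * outer y = qform 1 y *: outer y.
Proof.
rewrite /outer -mulmxE mulmxA -(mulmxA y) qform1E -scalemx1 -scalemxAr -!scalemxAl.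
by rewrite mulmx1.
Qed.

Lemma outer_herm y : (outer y)^t* = outer y.
Proof. by rewrite /outer trmx_mul map_mxM trmxCK. Qed.

(** Cauchy-Schwarz. *)
Lemma qform_outer_le y v : qform (outer y) v <= qform 1 y * qform 1 v.
Proof.
rewrite qform_outer.
have CS : `|dotmx (y^t*) (v^t*)| ^+ 2 <=
    dotmx (y^t*) (y^t*) * dotmx (v^t*) (v^t*).
  exact: (CauchySchwarz (@dotmx C n) (y^t*) (v^t*)).1.
by move: CS; rewrite !dotmxE !trmxCK !qform1E !(mxE scalar_mx_key) !eqxx !mulr1n.
Qed.

Lemma norm1_outer y : norm1 (outer y) <= n%:R * (n%:R * qform 1 y).
Proof.
rewrite /norm1 -[n in n%:R * (_ * _)]card_ord mulr_natl -sumr_const.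
apply: ler_sum => i _; rewrite mulr_natl -[n in _ *+ n]card_ord -sumr_const.
apply: ler_sum => j _; rewrite mxE big_ord1 !mxE normrM norm_conjC.
have yle k : `|y k 0| ^+ 2 <= qform 1 y.
  by rewrite qform1 (bigD1 k)//= lerDl sumr_ge0// => l _; rewrite exprn_ge0.
rewrite -(ler_pM2l (ltr0n _ 2)).
apply: (@le_trans _ _ (`|y i 0| ^+ 2 + `|y j 0| ^+ 2)); last first.
  by rewrite mulrDl mul1r lerD.
rewrite -subr_ge0.
have -> : `|y i 0| ^+ 2 + `|y j 0| ^+ 2 - 2 * (`|y i 0| * `|y j 0|)
   = (`|y i 0| - `|y j 0|) ^+ 2 by ring.
by rewrite -realEsqr realB // ?normr_real.
Qed.

End rank_one.

Section step.
Context {C : numClosedFieldType} {n : nat}.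
Variables (m : nat) (K : 'M[C]_n) (L sz : C).
Hypotheses (hK : K^t* = K) (pK : psd K) (KL : psd (L *: (1 : 'M[C]_n) - K))
  (L0 : 0 <= L) (sz0 : 0 < sz).
Local Notation N := (2 ^ m.+1)%N.

Lemma norm_qform_sub_outer_le (a : C) y v : `|a| * L <= 1 / 2 ->
  qform 1 y <= L ->
  `|qform (a *: (outer y - K)) v| <= 1 / 2 * qform 1 v.
Proof.
move=> aL yL; rewrite qformZ qformB normrM.
have v0 := qform1_ge0 v.
have b1 : qform K v <= L * qform 1 v.
  by have := KL v; rewrite qformB qformZ subr_ge0.
have b2 : qform (outer y) v <= L * qform 1 v.
  by apply: le_trans (qform_outer_le _ _) _; rewrite ler_wpM2r.
have b3 : 0 <= qform (outer y) v by rewrite qform_outer exprn_ge0.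
have b4 : `|qform (outer y) v - qform K v| <= L * qform 1 v.
  rewrite real_ler_norml; last first.
    by apply: realB; apply: ger0_real => //; exact: pK.
  rewrite lerBlDr ler_wpDr ?pK//= ?andbT.
  by rewrite lerBrDr addrC (le_trans _ b3)// subr_le0.
apply: (@le_trans _ _ (`|a| * (L * qform 1 v))); first by rewrite ler_wpM2l.
by rewrite mulrA ler_wpM2r.
Qed.

(** The relative growth of the potential in one step: (2/3) a^2 L is the
    variance factor and 1 / sz the weight of one of sz samples. *)
Definition step_gain (a : C) : C := 2 / 3 * a ^+ 2 * L / sz.

(** The bound on the potential after a step is affine in outer y, so that its
    mean over a random y with mean matrix K is k + tr (W K), whatever the law
    of y is.  The linear term in outer y - K cancels in that mean.  The
    quadratic one is at most (2/3) a^2 L tr (Q K) with Q the compound of S, and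
    sz K <= 1 bounds tr (Q (sz K)) by the trace of the excess plus
    tr (sz K) + tr (S (sz K)): the trace of K takes the place of the
    dimension. *)
Lemma excess_step (a c err : C) (S : 'M[C]_n) :
  a \is Num.real -> `|a| * L <= 1 / 2 -> S^t* = S ->
  (forall Z : 'M[C]_n, Z^t* = Z -> norm1 Z <= c ->
     (forall v, `|qform Z v| <= 1 / 2 * qform 1 v) ->
    \tr (compound N (S + Z)) <=
    \tr (compound N S * (1 + Z + (2 / 3) *: Z ^+ 2)) + err) ->
  0 <= \tr (excess N S * (1 - sz *: K)) ->
  (forall y, qform 1 y <= L -> norm1 (a *: (outer y - K)) <= c) ->
  exists W k,
    (forall y, qform 1 y <= L ->
      \tr (excess N (S + a *: (outer y - K))) <= k + \tr (W * outer y)) /\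
    k + \tr (W * K) <= (1 + step_gain a) * \tr (excess N S)
      + step_gain a * (\tr (sz *: K) + \tr (S * (sz *: K))) + err.
Proof.
move=> ra aL hS add_le exK Zc; set Q := compound N S.
set b : C := (2 / 3) * a ^+ 2.
(* The terms of tr (Q (1 + Z + (2/3) Z^2)) - tr (1 + S + Z) that are linear in
   outer y, after outer y ^+ 2 has been replaced by its upper bound
   L *: outer y; k collects the constant terms. *)
exists (a *: Q + b *: (L *: Q - K * Q - Q * K) - a *: (1 : 'M[C]_n)).
exists (\tr Q - a * \tr (Q * K) + b * \tr (Q * (K * K)) + err
  - \tr (1 : 'M[C]_n) - \tr S + a * \tr K).
have N0 : (0 < N)%N by rewrite expn_gt0.
have evN : ~~ odd N by rewrite oddX.
pose H : 'M[C]_n := (1 + N%:R^-1 *: S) ^+ (2 ^ m).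
have QE : Q = H ^+ 2 by rewrite /Q /compound -exprM -expnSr.
have hH : H^t* = H by rewrite adjX affine_herm.
have b0 : 0 <= b by rewrite mulr_ge0 ?divr_ge0 ?ler0n// -realEsqr.
have trQ (B : 'M[C]_n) : psd B -> 0 <= \tr (Q * B).
  by move=> pB; rewrite QE; exact: mxtrace_sq_psd_ge0.
split.
  move=> y yL; set Y := outer y; set Z := a *: (Y - K).
  have hZ : Z^t* = Z.
    rewrite /Z linearZ /= map_mxZ linearB /= map_mxB hK outer_herm.
    by congr (_ *: _); exact/CrealP.
  have le1 := add_le Z hZ (Zc y yL) (fun v => norm_qform_sub_outer_le v aL yL).
  have sqb : \tr (Q * (Y * Y)) <= L * \tr (Q * Y).
    have tQY : 0 <= \tr (Q * Y) by apply: trQ => v; rewrite qform_outer exprn_ge0.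
    by rewrite outer_sq -mulmxE -scalemxAr mxtraceZ ler_wpM2r.
  have E1 : \tr (Q * (1 + Z + (2 / 3) *: Z ^+ 2)) =
      \tr Q + a * \tr (Q * Y) - a * \tr (Q * K)
      + b * (\tr (Q * (Y * Y)) - \tr (K * Q * Y) - \tr (Q * K * Y)
             + \tr (Q * (K * K))).
    have -> : Z ^+ 2 = a ^+ 2 *: (Y * Y - Y * K - K * Y + K * K).
      rewrite expr2 /Z -mulmxE -scalemxAl -scalemxAr scalerA -expr2; congr (_ *: _).
      by rewrite mulmxBl !mulmxBr opprB addrA addrAC.
    rewrite !(mulrBr, mulrDr, mulrN, scalemxAr_ring) mulr1.
    rewrite -(mulrA K) (mxtraceMC K) -!(mulrA Q).
    rewrite !(mxtraceB, mxtraceD, mxtraceZ) /b; ring.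
  have E2 : \tr ((a *: Q + b *: (L *: Q - K * Q - Q * K) - a *: (1 : 'M[C]_n)) * Y) =
      a * \tr (Q * Y) + b * (L * \tr (Q * Y) - \tr (K * Q * Y) - \tr (Q * K * Y))
      - a * \tr Y.
    rewrite !(mulrBl, mulrDl, mulNr, scalemxAl_ring) mul1r.
    by rewrite !(mxtraceB, mxtraceD, mxtraceZ).
  have E3 : \tr (excess N (S + Z)) = \tr (compound N (S + Z)) - \tr (1 : 'M[C]_n)
      - (\tr S + a * \tr Y - a * \tr K).
    rewrite /excess /Z !(mxtraceB, mxtraceD, mxtraceZ); ring.
  rewrite E2 E3 -subr_ge0.
  move: le1 sqb; rewrite E1 -subr_ge0 => le1; rewrite -subr_ge0 => sqb.
  apply: le_trans (addr_ge0 le1 (mulr_ge0 b0 sqb)) _.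
  by rewrite le_eqVlt; apply/orP; left; apply/eqP; ring.
have pKK : psd (K * K).
  move=> v; have := qform1_ge0 (K *m v); rewrite /qform trmx_mul map_mxM hK mulmx1.
  by rewrite -mulmxE !mulmxA.
have g0 : 0 <= step_gain a by rewrite /step_gain -/b divr_ge0 ?(ltW sz0)// mulr_ge0.
have sz_neq0 : sz != 0 by rewrite gt_eqF.
rewrite -subr_ge0.
apply: le_trans (addr_ge0 (mulr_ge0 g0 exK) (mulr_ge0 b0 (trQ _ pKK))) _.
rewrite le_eqVlt; apply/orP; left; apply/eqP.
have F1 : \tr ((a *: Q + b *: (L *: Q - K * Q - Q * K) - a *: (1 : 'M[C]_n)) * K) =
    a * \tr (Q * K) + b * (L * \tr (Q * K) - \tr (Q * (K * K)) - \tr (Q * (K * K)))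
    - a * \tr K.
  rewrite !(mulrBl, mulrDl, mulNr, scalemxAl_ring) mul1r.
  rewrite !(mxtraceB, mxtraceD, mxtraceZ).
  by rewrite -(mulrA K) (mxtraceMC K) -!(mulrA Q).
have F2 : \tr (excess N S * (1 - sz *: K)) = \tr (excess N S)
   - sz * (\tr (Q * K) - \tr K - \tr (S * K)).
  rewrite mulrBr mulr1 scalemxAr_ring mxtraceB mxtraceZ; congr (_ - _ * _).
  by rewrite /excess !mulrBl mul1r !mxtraceB.
rewrite F1 F2 scalemxAr_ring !mxtraceZ.
rewrite /excess -/Q !mxtraceB /step_gain.
by rewrite /b; field.
Qed.

End step.

(** * Constants of the tail bound *)

Section scalars.
Context {R : realType}.
Implicit Types x y c : R.

Lemma compound_le_expR x k : 0 <= x -> (1 + x) ^+ k <= expR (k%:R * x).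
Proof.
move=> x0; rewrite expRM_natl.
by apply: lerXn2r; rewrite ?nnegrE ?expR_ge0 ?addr_ge0// expR_ge1Dx.
Qed.

(** A compound power with a large exponent loses at most the factor
    e^(-1/4) > 3/4 against the exponential. *)
Lemma expR_le_compound y (N : nat) : 0 <= y -> (0 < N)%N -> 4 * y ^+ 2 <= N%:R ->
  3 / 4 * expR y <= (1 + N%:R^-1 * y) ^+ N.
Proof.
move=> y0 N0 yN; have N0' : 0 < N%:R :> R by rewrite ltr0n.
set u := N%:R^-1 * y; have u0 : 0 <= u by rewrite /u mulr_ge0// invr_ge0 ltW.
have uN : N%:R * u = y by rewrite /u mulrA divff ?gt_eqF// mul1r.
(* u - u^2 <= u / (1 + u) <= ln (1 + u), and N u^2 = y^2 / N <= 1/4. *)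
have step : expR (u - u ^+ 2) <= 1 + u.
  have u1 : 0 < 1 + u by lra.
  apply: (@le_trans _ _ (expR (u / (1 + u)))).
    rewrite ler_expR ler_pdivlMr//.
    have : 0 <= u ^+ 3 by rewrite exprn_ge0.
    nra.
  have := expR_ge1Dx (- (u / (1 + u))).
  have -> : 1 + - (u / (1 + u)) = (1 + u)^-1 by field; rewrite gt_eqF.
  by rewrite expRN lef_pV2 ?posrE ?expR_gt0.
have : expR (y - N%:R * u ^+ 2) <= (1 + u) ^+ N.
  have -> : y - N%:R * u ^+ 2 = N%:R * (u - u ^+ 2) by rewrite mulrBr uN.
  rewrite expRM_natl; apply: lerXn2r => //; rewrite nnegrE ?expR_ge0//.
  exact: addr_ge0.
apply: le_trans.
have q4 : N%:R * u ^+ 2 <= 1 / 4.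
  rewrite -(ler_pM2r N0') (_ : _ * N%:R = (N%:R * u) ^+ 2); last by ring.
  by rewrite uN; lra.
have h := expR_ge1Dx (- (N%:R * u ^+ 2)).
by rewrite expRD [leLHS]mulrC ler_wpM2l ?expR_ge0//; lra.
Qed.

Lemma trotter_error_le (N : nat) c : (0 < N)%N -> 0 <= c ->
  trotter_error N c <= expR (2 * c + c ^+ 2) * (N%:R^-1 * c ^+ 2).
Proof.
move=> N0 c0; have N0' : 0 < N%:R :> R by rewrite ltr0n.
have -> : trotter_error N c =
    (1 + N%:R^-1 * (2 * c + c ^+ 2)) ^+ N * (N%:R^-1 * c ^+ 2).
  rewrite /trotter_error; field; exact: lt0r_neq0.
apply: ler_wpM2r; first by rewrite mulr_ge0 ?sqr_ge0// invr_ge0 ltW.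
have K0 : 0 <= 2 * c + c ^+ 2 by rewrite addr_ge0 ?sqr_ge0// mulr_ge0.
apply: le_trans (compound_le_expR _ _) _.
  by rewrite mulr_ge0// invr_ge0 ltW.
by rewrite mulrA divff ?gt_eqF// mul1r.
Qed.

(** N is chosen after all other data: so large that q steps cost little and the
    compound power of the threshold y is close to e^y. *)
Lemma exists_fine_compound y c (sl q : R) : 0 <= y -> 0 <= c -> 0 < sl -> 0 <= q ->
  exists m, let N := (2 ^ m.+1)%N in
    q * trotter_error N c <= sl /\ 3 / 4 * expR y <= (1 + N%:R^-1 * y) ^+ N.
Proof.
move=> y0 c0 sl0 q0.
(* Both requirements hold as soon as N >= B. *)
pose B := 4 * y ^+ 2 + q * (expR (2 * c + c ^+ 2) * c ^+ 2) / sl.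
pose m := Num.truncn B.
exists m => N.
have N0 : (0 < N)%N by rewrite expn_gt0.
have N0' : 0 < N%:R :> R by rewrite ltr0n.
have BN : B <= N%:R.
  apply: (@le_trans _ _ (m.+1)%:R).
    by apply/ltW; exact: truncnS_gt.
  by rewrite ler_nat ltnW// ltn_expl.
have B1 : 0 <= 4 * y ^+ 2 by rewrite mulr_ge0 ?sqr_ge0.
have B2 : 0 <= q * (expR (2 * c + c ^+ 2) * c ^+ 2) / sl.
  by rewrite divr_ge0 ?(ltW sl0)// !mulr_ge0 ?sqr_ge0 ?expR_ge0.
split; last by apply: expR_le_compound => //; apply: le_trans BN; rewrite lerDl.
apply: le_trans (ler_wpM2l q0 (trotter_error_le N0 c0)) _.
have : q * (expR (2 * c + c ^+ 2) * c ^+ 2) / sl <= N%:R.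
  by apply: le_trans BN; rewrite lerDr.
rewrite ler_pdivrMr// => h.
rewrite (_ : q * _ = q * (expR (2 * c + c ^+ 2) * c ^+ 2) / N%:R); last by ring.
by rewrite ler_pdivrMr// [leRHS]mulrC.
Qed.

(** The final arithmetic of the tail bound.  Here h stands for the compound
    power of the threshold y, and e^(y/2) for the growth of the potential; the
    quotient of the expected potential by its value h - 1 - y at the threshold
    must be at most dl / 2. *)
Lemma tail_numerics (y sl dl h : R) : 0 < dl -> dl < 1 -> 1 / 2 <= sl ->
  ln (16 * sl / dl) <= y / 2 ->
  3 / 4 * expR y <= h ->
  expR (y / 2) * (2 * sl) <= dl / 2 * (h - 1 - y) /\ 0 < h - 1 - y.
Proof.
move=> dl0 dl1 sl2 lny hy.
set F := expR (y / 2).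
have FE : 16 * sl / dl <= F.
  rewrite -[leLHS]lnK; last by rewrite posrE divr_gt0// mulr_gt0//; lra.
  by rewrite ler_expR.
(* F >= 8 makes (3/4) F^2 - 1 - y at least F^2 / 2. *)
have F8 : 8 <= F.
  apply: le_trans FE; rewrite ler_pdivlMr//; lra.
have yE : expR y = F ^+ 2 by rewrite -expRM_natl; congr expR; field.
have F1 : 1 + y / 2 <= F by exact: expR_ge1Dx.
have hF : F ^+ 2 / 2 <= h - 1 - y.
  move: hy; rewrite yE; nra.
have FE' : 16 * sl <= F * dl by rewrite -ler_pdivrMr.
split; last by apply: lt_le_trans hF; nra.
have : dl / 2 * (F ^+ 2 / 2) <= dl / 2 * (h - 1 - y).
  by rewrite ler_wpM2l//; lra.
apply: le_trans.
have : F * (16 * sl) <= F * (F * dl) by rewrite ler_wpM2l//; lra.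
have : 0 <= F * sl by rewrite mulr_ge0//; lra.
nra.
Qed.

End scalars.

(** * Markov's inequality and laws of independent samples *)

Lemma measurable_ge_level d (T : measurableType d) (R : realType) (f : T -> R) (h : R) :
  measurable_fun setT f -> measurable [set t | h <= f t].
Proof.
move=> mf; have := mf measurableT _ (measurable_itv `[h, +oo[); rewrite setTI.
rewrite (_ : _ @^-1` _ = [set t | h <= f t])//.
by apply/seteqP; split => t /=; rewrite in_itv /= andbT.
Qed.

Lemma markov_ge0 d (T : measurableType d) (R : realType)
    (mu : {measure set T -> \bar R}) (f : T -> R) (h b : R) :
  measurable_fun setT f -> (forall t, 0 <= f t) -> 0 < h ->
  (\int[mu]_t (f t)%:E <= b%:E)%E -> (mu [set t | (h <= f t)%R] <= (b / h)%:E)%E.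
Proof.
move=> mf f0 h0 fb.
have H := @le_integral_comp_abse _ _ _ mu _ measurableT (EFin \o f) h id
  (@measurable_id _ _ _) (fun r r0 => r0) (fun x y _ _ xy => xy) _ h0.
have {H}/(_ _)/wrap[] := H; first exact/measurable_EFinP.
rewrite setTI => H.
rewrite -(@lee_pmul2l _ h%:E)//.
rewrite -EFinM mulrCA divff ?gt_eqF// mulr1.
apply: le_trans fb; apply: le_trans (le_trans _ H) _.
  rewrite le_eqVlt; apply/orP; left; apply/eqP; congr (_ * mu _)%E.
  by apply/seteqP; split => t /=; rewrite lee_fin ger0_norm.
rewrite le_eqVlt; apply/orP; left; apply/eqP.
by apply: eq_integral => t _ /=; rewrite ger0_norm.
Qed.

Section iid_law.
Context d (T : measurableType d) (R : realType).
Variable nu : probability T R.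

Definition cons_tuple k (x : T * k.-tuple T) : k.+1.-tuple T := [tuple of x.1 :: x.2].

Lemma measurable_cons_tuple k : measurable_fun setT (@cons_tuple k).
Proof. exact: measurable_cons. Qed.

HB.instance Definition _ k :=
  isMeasurableFun.Build _ _ _ _ (@cons_tuple k) (@measurable_cons_tuple k).

(** The product law is built by recursion on the number of samples, so that
    an estimate for one sample can be iterated by Fubini's theorem. *)
Fixpoint iid_law k : probability (k.-tuple T) R :=
  match k with
  | 0 => [the probability (0.-tuple T) R of \d_([tuple] : 0.-tuple T)]
  | k.+1 => [the probability (k.+1.-tuple T) R of
      distribution (nu \x iid_law k)%E (@cons_tuple k)]
  end.

Definition rect k (B : 'I_k -> set T) : set (k.-tuple T) :=
  [set t | forall i, B i (tnth t i)].

Lemma measurable_rect k (B : 'I_k -> set T) : (forall i, measurable (B i)) ->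
  measurable (rect B).
Proof.
move=> mB; rewrite (_ : rect B = \bigcap_(i in setT) ((@tnth k T)^~ i @^-1` B i)).
  apply: fin_bigcap_measurable => // i _; rewrite -[X in measurable X]setTI.
  exact: (measurable_tnth i).
by apply/seteqP; split => t /= H i; [move=> _|]; apply: H.
Qed.

Lemma iid_law_rect k (B : 'I_k -> set T) : (forall i, measurable (B i)) ->
  iid_law k (rect B) = (\prod_(i < k) nu (B i))%E.
Proof.
elim: k B => [|k IH] B mB.
  by rewrite big_ord0 /= diracE mem_set//= => -[].
rewrite big_ord_recl -IH//= /distribution /pushforward.
rewrite (_ : _ @^-1` _ = B ord0 `*` rect (fun i => B (lift ord0 i))).
  by rewrite product_measure1E//; exact: measurable_rect.
apply/seteqP; split => [[x t] /= H|[x t] /= [Hx Ht] i].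
  split; first by have := H ord0.
  by move=> i; have := H (lift ord0 i); rewrite tnthS.
by case: (unliftP ord0 i) => [j ->|->//]; rewrite tnthS; exact: Ht.
Qed.

(** Independence prescribes the probabilities of rectangles only; this extends
    the identification to all events. *)
Lemma iid_law_unique k (mu : probability (k.-tuple T) R) :
  (forall B : 'I_k -> set T, (forall i, measurable (B i)) ->
    mu (rect B) = (\prod_(i < k) nu (B i))%E) ->
  forall A, measurable A -> mu A = iid_law k A.
Proof.
move=> mu_rect.
(* Rectangles are closed under intersection and generate the product
   sigma-algebra. *)
pose G := [set rect B | B in [set B : 'I_k -> set T | forall i, measurable (B i)]].
have rectT : rect (fun=> setT) = [set: k.-tuple T] by apply/seteqP; split.
apply: (@measure_unique _ _ _ G (fun=> setT)).
- apply/seteqP; split.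
    apply: smallest_sub; first exact: smallest_sigma_algebra.
    move=> A; rewrite -bigcup_seq => -[i _ [C mC <-]].
    apply: sub_sigma_algebra; exists (fun j => if j == i then C else setT) => /=.
      by move=> j; case: ifP.
    apply/seteqP; split => t /=; first by move=> /(_ i); rewrite eqxx.
    by move=> [_ Ct] j; case: ifP => // /eqP ->.
  apply: smallest_sub; first exact: sigma_algebra_measurable.
  by move=> _ [B mB <-]; exact: measurable_rect.
- move=> _ _ [B mB <-] [B' mB' <-]; exists (fun i => B i `&` B' i).
    by move=> i /=; exact: measurableI.
  apply/seteqP; split => t /=; first by move=> H; split => i; have [] := H i.
  by move=> [H H'] i; split; [exact: H|exact: H'].
- by move=> _; exists (fun=> setT).
- by rewrite bigcup_const.
- by move=> _ [B mB <-]; apply: etrans (mu_rect _ mB) _; exact/esym/iid_law_rect.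
- by move=> _; rewrite /= probability_setT ltry.
Qed.

Lemma ge0_integral_iid_law k (f : k.+1.-tuple T -> R) :
  measurable_fun [set: k.+1.-tuple T] f -> (forall t, 0 <= f t) ->
  (\int[iid_law k.+1]_t (f t)%:E =
   \int[nu]_x \int[iid_law k]_t (f (cons_tuple (x, t)))%:E)%E.
Proof.
move=> mf f0; rewrite ge0_integral_distribution//=; last first.
  exact/measurable_EFinP.
rewrite fubini_tonelli1//.
  by apply/measurable_EFinP; exact: measurableT_comp.
by move=> x; rewrite lee_fin.
Qed.

End iid_law.

(** * Measurability of complex and matrix-valued functions *)

Section reim.
Context {R : rcfType}.
Implicit Types x y : R[i].
Lemma cReD x y : Re (x + y) = Re x + Re y. Proof. by case: x y => ? ? []. Qed.
Lemma cImD x y : Im (x + y) = Im x + Im y. Proof. by case: x y => ? ? []. Qed.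
Lemma cReN x : Re (- x) = - Re x. Proof. by case: x. Qed.
Lemma cImN x : Im (- x) = - Im x. Proof. by case: x. Qed.
Lemma cReB x y : Re (x - y) = Re x - Re y. Proof. by rewrite cReD cReN. Qed.
Lemma cReM x y : Re (x * y) = Re x * Re y - Im x * Im y. Proof. by case: x y => ? ? []. Qed.
Lemma cImM x y : Im (x * y) = Re x * Im y + Im x * Re y. Proof. by case: x y => ? ? []. Qed.
Lemma cRe_conj x : Re (x^*) = Re x. Proof. by case: x. Qed.
Lemma cIm_conj x : Im (x^*) = - Im x. Proof. by case: x. Qed.
Lemma cReZ (a : R) x : Re (a%:C%C * x) = a * Re x.
Proof. by rewrite cReM /= mul0r subr0. Qed.
Lemma ler_Re x y : x <= y -> Re x <= Re y.
Proof. by rewrite lecE => /andP[]. Qed.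
End reim.

Section cmeasurable_closure.
Context d (T : measurableType d) (R : realType) (D : set T).
Hypothesis mD : measurable D.
Implicit Types f g : T -> R[i].

Lemma cmeasurable_cst (c : R[i]) : cmeasurable D (fun=> c).
Proof. by split; exact: measurable_cst. Qed.

Lemma cmeasurableD f g : cmeasurable D f -> cmeasurable D g ->
  cmeasurable D (fun t => f t + g t).
Proof.
move=> [f1 f2] [g1 g2]; split.
  by under eq_fun do rewrite cReD; exact: measurable_funD.
by under eq_fun do rewrite cImD; exact: measurable_funD.
Qed.

Lemma cmeasurableM f g : cmeasurable D f -> cmeasurable D g ->
  cmeasurable D (fun t => f t * g t).
Proof.
move=> [f1 f2] [g1 g2]; split.
  by under eq_fun do rewrite cReM; apply: measurable_funB; exact: measurable_funM.
by under eq_fun do rewrite cImM; apply: measurable_funD; exact: measurable_funM.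
Qed.

Lemma cmeasurable_conj f : cmeasurable D f -> cmeasurable D (fun t => (f t)^*).
Proof.
move=> [f1 f2]; split; first by under eq_fun do rewrite cRe_conj.
by under eq_fun do rewrite cIm_conj; exact: measurableT_comp.
Qed.

Lemma cmeasurable_real (f : T -> R) : measurable_fun D f ->
  cmeasurable D (fun t => (f t)%:C%C).
Proof. by move=> mf; split => //=; exact: measurable_cst. Qed.

Lemma cmeasurable_sum (I : Type) (r : seq I) (F : I -> T -> R[i]) :
  (forall i, cmeasurable D (F i)) -> cmeasurable D (fun t => \sum_(i <- r) F i t).
Proof.
move=> mF; elim: r => [|i r IH].
  by under eq_fun do rewrite big_nil; exact: cmeasurable_cst.
by under eq_fun do rewrite big_cons; exact: cmeasurableD.
Qed.

Definition mxmeasurable p q (F : T -> 'M[R[i]]_(p, q)) : Prop :=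
  forall i j, cmeasurable D (fun t => F t i j).

Lemma mxmeasurable_cst p q (A : 'M[R[i]]_(p, q)) : mxmeasurable (fun=> A).
Proof. by move=> i j; exact: cmeasurable_cst. Qed.

Lemma mxmeasurableD p q (F G : T -> 'M[R[i]]_(p, q)) :
  mxmeasurable F -> mxmeasurable G -> mxmeasurable (fun t => F t + G t).
Proof.
by move=> mF mG i j; under eq_fun do rewrite mxE; exact: cmeasurableD.
Qed.

Lemma mxmeasurableZ p q (a : T -> R[i]) (F : T -> 'M[R[i]]_(p, q)) :
  cmeasurable D a -> mxmeasurable F -> mxmeasurable (fun t => a t *: F t).
Proof.
by move=> ma mF i j; under eq_fun do rewrite mxE; exact: cmeasurableM.
Qed.

Lemma mxmeasurable_mulmx p q r (F : T -> 'M[R[i]]_(p, q)) (G : T -> 'M[R[i]]_(q, r)) :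
  mxmeasurable F -> mxmeasurable G -> mxmeasurable (fun t => F t *m G t).
Proof.
move=> mF mG i j; under eq_fun do rewrite mxE.
by apply: cmeasurable_sum => k; exact: cmeasurableM.
Qed.

Lemma mxmeasurable_adj p q (F : T -> 'M[R[i]]_(p, q)) :
  mxmeasurable F -> mxmeasurable (fun t => (F t)^t*).
Proof.
move=> mF i j; under eq_fun do rewrite !mxE.
exact: cmeasurable_conj.
Qed.

Lemma mxmeasurableX p k (F : T -> 'M[R[i]]_p) :
  mxmeasurable F -> mxmeasurable (fun t => F t ^+ k).
Proof.
move=> mF; elim: k => [|k IH].
  by under eq_fun do rewrite expr0; exact: mxmeasurable_cst.
by under eq_fun do rewrite exprS; exact: mxmeasurable_mulmx.
Qed.

Lemma cmeasurable_mxtrace p (F : T -> 'M[R[i]]_p) :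
  mxmeasurable F -> cmeasurable D (fun t => \tr (F t)).
Proof. by move=> mF; exact: cmeasurable_sum. Qed.

Lemma mxmeasurable_excess N p (F : T -> 'M[R[i]]_p) :
  mxmeasurable F -> mxmeasurable (fun t => excess N (F t)).
Proof.
move=> mF; rewrite /excess /compound.
have mN (G : T -> 'M[R[i]]_p) : mxmeasurable G -> mxmeasurable (fun t => - G t).
  move=> mG i j; have [m1 m2] := mG i j; split; under eq_fun do rewrite mxE ?cReN ?cImN;
    exact: measurableT_comp.
apply: mxmeasurableD; last exact: mN.
apply: mxmeasurableD; last by apply: mN; exact: mxmeasurable_cst.
apply: mxmeasurableX; apply: mxmeasurableD; first exact: mxmeasurable_cst.
by apply: mxmeasurableZ => //; exact: cmeasurable_cst.
Qed.

Lemma mxmeasurable_sum p q (I : Type) (r : seq I) (F : I -> T -> 'M[R[i]]_(p, q)) :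
  (forall i, mxmeasurable (F i)) -> mxmeasurable (fun t => \sum_(i <- r) F i t).
Proof.
move=> mF; elim: r => [|i r IH].
  by under eq_fun do rewrite big_nil; exact: mxmeasurable_cst.
by under eq_fun do rewrite big_cons; exact: mxmeasurableD.
Qed.

End cmeasurable_closure.

(** * Integrals of complex functions *)

Section complex_integral.
Context d (T : measurableType d) (R : realType).
Variables (mu : {measure set T -> \bar R}) (D : set T).
Hypothesis mD : measurable D.
Implicit Types f g : T -> R[i].

Definition cintegrable f : Prop :=
  mu.-integrable D (EFin \o (fun t => Re (f t))) /\
  mu.-integrable D (EFin \o (fun t => Im (f t))).

Lemma Re_cintegral f : Re (cintegral mu D f) = \int[mu]_(t in D) Re (f t).
Proof. by []. Qed.

Lemma eq_complex_parts (x y : R[i]) : Re x = Re y -> Im x = Im y -> x = y.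
Proof. by case: x y => a b [a' b'] /= -> ->. Qed.

Lemma integrableD_EFin (f g : T -> R) : mu.-integrable D (EFin \o f) ->
  mu.-integrable D (EFin \o g) -> mu.-integrable D (EFin \o (fun t => f t + g t)).
Proof. by move=> If Ig; have := integrableD mD If Ig; apply: eq_integrable. Qed.

Lemma integrableB_EFin (f g : T -> R) : mu.-integrable D (EFin \o f) ->
  mu.-integrable D (EFin \o g) -> mu.-integrable D (EFin \o (fun t => f t - g t)).
Proof. by move=> If Ig; have := integrableB mD If Ig; apply: eq_integrable. Qed.

Lemma integrableZ_EFin (c : R) (f : T -> R) : mu.-integrable D (EFin \o f) ->
  mu.-integrable D (EFin \o (fun t => c * f t)).
Proof. by move=> If; have := integrableZl mD c If; apply: eq_integrable. Qed.

Lemma eq_cintegrable f g : {in D, f =1 g} -> cintegrable f -> cintegrable g.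
Proof.
by move=> fg [h1 h2]; split; [apply: eq_integrable h1|apply: eq_integrable h2];
  move=> // t tD /=; rewrite fg.
Qed.

Lemma eq_cintegral f g : {in D, f =1 g} -> cintegral mu D f = cintegral mu D g.
Proof.
by move=> fg; apply: eq_complex_parts; apply: eq_Rintegral => t tD; rewrite fg.
Qed.

Lemma cintegrable0 : cintegrable (fun=> 0).
Proof. by split; exact: integrable0. Qed.

Lemma cintegral0 : cintegral mu D (fun=> 0) = 0.
Proof.
by apply: eq_complex_parts; rewrite /= /Rintegral integral0.
Qed.

Lemma cintegrableD f g : cintegrable f -> cintegrable g ->
  cintegrable (fun t => f t + g t).
Proof.
move=> [f1 f2] [g1 g2]; split; under eq_fun do rewrite ?cReD ?cImD;
  exact: integrableD_EFin.
Qed.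

Lemma cintegralD f g : cintegrable f -> cintegrable g ->
  cintegral mu D (fun t => f t + g t) = cintegral mu D f + cintegral mu D g.
Proof.
move=> [f1 f2] [g1 g2]; apply: eq_complex_parts; rewrite ?cReD ?cImD /=.
  by under eq_Rintegral do rewrite cReD; rewrite RintegralD.
by under eq_Rintegral do rewrite cImD; rewrite RintegralD.
Qed.

Lemma cintegrableZ c f : cintegrable f -> cintegrable (fun t => c * f t).
Proof.
move=> [f1 f2]; split.
  under eq_fun do rewrite cReM.
  by apply: integrableB_EFin; exact: integrableZ_EFin.
under eq_fun do rewrite cImM.
by apply: integrableD_EFin; exact: integrableZ_EFin.
Qed.

Lemma cintegralZ c f : cintegrable f ->
  cintegral mu D (fun t => c * f t) = c * cintegral mu D f.
Proof.
move=> [f1 f2]; apply: eq_complex_parts; rewrite ?cReM ?cImM /=.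
  under eq_Rintegral do rewrite cReM.
  by rewrite RintegralB ?RintegralZl//; exact: integrableZ_EFin.
under eq_Rintegral do rewrite cImM.
by rewrite RintegralD ?RintegralZl//; exact: integrableZ_EFin.
Qed.

Lemma cintegrable_sum (I : Type) (r : seq I) (F : I -> T -> R[i]) :
  (forall i, cintegrable (F i)) -> cintegrable (fun t => \sum_(i <- r) F i t).
Proof.
move=> mF; elim: r => [|i r IH].
  by under eq_fun do rewrite big_nil; exact: cintegrable0.
by under eq_fun do rewrite big_cons; exact: cintegrableD.
Qed.

Lemma cintegral_sum (I : Type) (r : seq I) (F : I -> T -> R[i]) :
  (forall i, cintegrable (F i)) ->
  cintegral mu D (fun t => \sum_(i <- r) F i t) = \sum_(i <- r) cintegral mu D (F i).
Proof.
move=> mF; elim: r => [|i r IH].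
  by under eq_fun do rewrite big_nil; rewrite big_nil cintegral0.
under eq_fun do rewrite big_cons.
by rewrite cintegralD// ?big_cons ?IH//; exact: cintegrable_sum.
Qed.

Lemma cintegral_mxtrace p (W : 'M[R[i]]_p) (F : T -> 'M[R[i]]_p) (K : 'M[R[i]]_p) :
  (forall i j, cintegrable (fun t => F t i j)) ->
  (forall i j, cintegral mu D (fun t => F t i j) = K i j) ->
  cintegrable (fun t => \tr (W * F t)) /\
  cintegral mu D (fun t => \tr (W * F t)) = \tr (W * K).
Proof.
move=> IF EF.
have E t : \tr (W * F t) = \sum_i \sum_j W i j * F t j i.
  by apply: eq_bigr => i _; rewrite mxE.
have I1 i j : cintegrable (fun t => W i j * F t j i) by exact: cintegrableZ.
under eq_fun do rewrite E; split.
  by apply: cintegrable_sum => i; exact: cintegrable_sum.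
rewrite cintegral_sum => [|i]; last exact: cintegrable_sum.
apply: eq_bigr => i _; rewrite cintegral_sum// mxE.
by apply: eq_bigr => j _; rewrite cintegralZ// EF.
Qed.

End complex_integral.

(** * The potential along independent samples *)

Lemma real_complex_is_real (R : rcfType) (x : R) : x%:C%C \is Num.real.
Proof. by apply/complex_realP; exists x. Qed.

Section iid_moment.
Context d (T : measurableType d) (R : realType) (nu : probability T R).
Context (n m : nat) (y : T -> 'cV[R[i]]_n) (K : 'M[R[i]]_n) (L sz a c1 c : R).
Local Notation N := (2 ^ m.+1)%N.
Local Notation C := R[i].
Hypotheses (my : mxmeasurable setT y) (yL : forall t, qform 1 (y t) <= L%:C%C).
Hypotheses (hK : K^t* = K) (pK : psd K) (KL : psd (L%:C%C *: (1 : 'M[C]_n) - K))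
  (K1 : psd ((1 : 'M[C]_n) - sz%:C%C *: K)) (L0 : 0 <= L) (sz0 : 0 < sz).
Hypothesis aL : `|a| * L <= 1 / 2.
Hypothesis Zc : forall y, qform 1 y <= L%:C%C ->
  norm1 (a%:C%C *: (outer y - K)) <= c1%:C%C.
Hypothesis mean_int : forall W : 'M[C]_n,
  nu.-integrable setT (fun t => (Re (\tr (W * outer (y t))))%:E).
Hypothesis mean : forall W : 'M[C]_n,
  (\int[nu]_t (Re (\tr (W * outer (y t))))%:E = (Re (\tr (W * K)))%:E)%E.

Definition centered t : 'M[C]_n := a%:C%C *: (outer (y t) - K).

Definition potential (S : 'M[C]_n) : R := Re (\tr (excess N S)).

Definition gain : R := 2 / 3 * a ^+ 2 * L / sz.

Lemma gain_ge0 : 0 <= gain.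
Proof.
apply: divr_ge0; last exact: ltW.
by apply: mulr_ge0 => //; apply: mulr_ge0; [lra|exact: sqr_ge0].
Qed.

Lemma exp2S_even : ~~ odd N. Proof. by rewrite oddX. Qed.
Lemma exp2S_gt0 : (0 < N)%N. Proof. by rewrite expn_gt0. Qed.

Lemma potential_ge0 S : S^t* = S -> 0 <= potential S.
Proof.
move=> hS; have := excess_mul_psd_ge0 exp2S_gt0 exp2S_even hS (@psd1 R n).
by rewrite mulr1 => /ler_Re.
Qed.

Lemma centered_herm t : (centered t)^t* = centered t.
Proof.
rewrite /centered linearZ /= map_mxZ linearB /= map_mxB hK outer_herm.
by congr (_ *: _); apply/CrealP; exact: real_complex_is_real.
Qed.

Lemma sum_centered_herm (r : seq T) :
  (\sum_(t <- r) centered t)^t* = \sum_(t <- r) centered t.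
Proof.
elim: r => [|t r IH]; first by rewrite big_nil linear0 /= map_mx0.
by rewrite big_cons linearD /= map_mxD IH centered_herm.
Qed.

(** [excess_step] with the error term of [compound_add_le], in real terms. *)
Lemma potential_step S : S^t* = S -> norm1 S <= c%:C%C -> c1 <= c ->
  exists W k,
    (forall t, potential (S + centered t) <= k + Re (\tr (W * outer (y t)))) /\
    k + Re (\tr (W * K)) <= (1 + gain) * potential S
      + gain * (Re (\tr (sz%:C%C *: K)) + Re (\tr (S * (sz%:C%C *: K))))
      + trotter_error N c.
Proof.
move=> hS Sc c1c.
have aL' : `|a%:C%C : C| * L%:C%C <= 1 / 2.
  rewrite normc_def /= expr0n addr0 sqrtr_sqr -rmorphM /=.
  have -> : 1 / 2 = (1 / 2)%:C%C :> C by rewrite fmorph_div /= rmorph1 rmorph_nat.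
  by rewrite lecR.
have L0' : 0 <= L%:C%C :> C by rewrite ler0c.
have sz0' : 0 < sz%:C%C :> C by rewrite ltcR.
have Zc' y' : qform 1 y' <= L%:C%C -> norm1 (a%:C%C *: (outer y' - K)) <= c%:C%C.
  by move=> /Zc /le_trans; apply; rewrite lecR.
have [||W [k [H1 H2]]] := @excess_step _ _ m K _ _ hK pK KL L0' sz0' a%:C%C c%:C%C
    (trotter_error N c)%:C%C S (real_complex_is_real _) aL' hS _ _ Zc'.
- by move=> Z hZ Zn Zq; exact: compound_add_le.
- exact: (excess_mul_psd_ge0 exp2S_gt0 exp2S_even).
exists W, (Re k); split.
  by move=> t; have /ler_Re := H1 _ (yL t); rewrite cReD.
have := ler_Re H2.
have -> : step_gain L%:C%C sz%:C%C a%:C%C = gain%:C%C.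
  by rewrite /step_gain /gain fmorph_div rmorphM rmorphM rmorphXn fmorph_div !rmorph_nat.
have -> : 1 + gain%:C%C = (1 + gain)%:C%C by rewrite rmorphD rmorph1.
by rewrite !cReD !cReZ cReD.
Qed.

(** What is added to the growth of the initial potential after k steps: a
    multiple of the trace of sz K and the accumulated approximation errors. *)
Definition budget k : R := ((1 + gain) ^+ k - 1) * Re (\tr (sz%:C%C *: K))
  + k%:R * (1 + gain) ^+ k * trotter_error N c.

Lemma measurable_potential_sum k S :
  measurable_fun [set: k.-tuple T]
    (fun t : k.-tuple T => potential (S + \sum_(x <- t) centered x)).
Proof.
suff /(cmeasurable_mxtrace (D := setT))[] : mxmeasurable [set: k.-tuple T]
  (fun t : k.-tuple T => excess N (S + \sum_(x <- t) centered x)) by [].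
apply: mxmeasurable_excess; apply: mxmeasurableD; first exact: mxmeasurable_cst.
under eq_fun do rewrite big_tuple.
apply: mxmeasurable_sum => i.
have mX : mxmeasurable setT centered.
  apply: mxmeasurableZ; first exact: cmeasurable_cst.
  apply: mxmeasurableD; last exact: mxmeasurable_cst.
  by apply: mxmeasurable_mulmx => //; exact: mxmeasurable_adj.
move=> p q; have [h1 h2] := mX p q; split.
  by apply: (measurableT_comp h1); exact: measurable_tnth.
by apply: (measurableT_comp h2); exact: measurable_tnth.
Qed.

Lemma trotter_error_ge0 k : 0 <= c -> 0 <= trotter_error k c.
Proof.
move=> c0; have k0 : 0 <= k%:R^-1 :> R by rewrite invr_ge0.
apply: mulr_ge0; first apply: mulr_ge0 => //.
  by rewrite exprn_ge0// addr_ge0// mulr_ge0// addr_ge0 ?sqr_ge0// mulr_ge0.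
by rewrite !mulr_ge0 ?sqr_ge0.
Qed.

(** The summands are centred, so the trace of S times sz K keeps its conditional
    mean from one sample to the next.  It is therefore carried through the
    induction unestimated, and it vanishes at the starting point S = 0. *)
Lemma expected_potential_le k S : S^t* = S -> 0 <= c1 -> 0 <= c ->
  norm1 S + (k%:R * c1)%:C%C <= c%:C%C ->
  (\int[iid_law nu k]_t (potential (S + \sum_(x <- t) centered x))%:E <=
   ((1 + gain) ^+ k * potential S + budget k
    + ((1 + gain) ^+ k - 1) * Re (\tr (S * (sz%:C%C *: K))))%:E)%E.
Proof.
move=> hS c10 c0; elim: k S hS => [|k IH] S hS Sc.
  rewrite (eq_integral (cst (potential S)%:E)); last first.
    by move=> t _; rewrite (tuple0 t) /= big_nil addr0.
  rewrite integral_cst; last exact: measurableT.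
  rewrite [X in (_ * X)%E](_ : _ = 1%E); last exact: (probability_setT (iid_law nu 0)).
  rewrite mule1 lee_fin /budget.
  by rewrite expr0 subrr !mul0r !addr0 mul1r.
rewrite ge0_integral_iid_law; last 2 first.
- exact: measurable_potential_sum.
- move=> t; apply: potential_ge0; rewrite linearD /= map_mxD hS.
  by rewrite sum_centered_herm.
have kc1 : k.+1%:R * c1 <= c.
  by rewrite -lecR; apply: le_trans Sc; rewrite lerDr norm1_ge0.
have c1c : c1 <= c.
  by apply: le_trans kc1; rewrite -natr1 mulrDl mul1r lerDr mulr_ge0.
have Sc' : norm1 S <= c%:C%C.
  by apply: le_trans Sc; rewrite lerDl ler0c mulr_ge0.
have [W [k0 [H1 H2]]] := potential_step hS Sc' c1c.
set M := sz%:C%C *: K in H2 *.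
pose Gk := (1 + gain) ^+ k.
have Gk1 : 1 <= Gk by rewrite exprn_ege1// lerDl gain_ge0.
have Gk0 : 0 <= Gk by apply: le_trans Gk1.
pose k1 : R := Gk * k0 + budget k + (Gk - 1) * (Re (\tr (S * M)) - a * Re (\tr (M * K))).
(* The bound given by IH at S + centered t is again affine in outer (y t),
   with slope W'. *)
have [W' W'E] : exists W' : 'M[C]_n, forall B, Re (\tr (W' * B)) =
    Gk * Re (\tr (W * B)) + (Gk - 1) * a * Re (\tr (M * B)).
  exists (Gk%:C%C *: W + ((Gk - 1) * a)%:C%C *: M) => B.
  by rewrite mulrDl !scalemxAl_ring mxtraceD !mxtraceZ cReD !cReZ.
have hSX t : (S + centered t)^t* = S + centered t.
  by rewrite linearD /= map_mxD hS centered_herm.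
have step t : (\int[iid_law nu k]_r
    (potential (S + \sum_(x <- cons_tuple (t, r)) centered x))%:E <=
    (k1 + Re (\tr (W' * outer (y t))))%:E)%E.
  under eq_integral do rewrite /= big_cons addrA.
  apply: (le_trans (IH _ (hSX t) _)).
    apply: le_trans Sc; rewrite -natr1 mulrDl mul1r rmorphD /= addrA addrAC lerD2r.
    by apply: le_trans (norm1D _ _) _; rewrite lerD2l; exact: Zc.
  rewrite lee_fin W'E -[(1 + gain) ^+ k]/Gk.
  have -> : Re (\tr ((S + centered t) * M)) = Re (\tr (S * M))
      + a * (Re (\tr (M * outer (y t))) - Re (\tr (M * K))).
    rewrite mulrDl /centered scalemxAl_ring mulrBl mxtraceD mxtraceZ mxtraceB.
    by rewrite cReD cReZ cReB (mxtraceMC (outer _)) (mxtraceMC K).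
  rewrite /k1; have := ler_wpM2l Gk0 (H1 t); lra.
have inner_ge0 t : (0 <= \int[iid_law nu k]_r
    (potential (S + \sum_(x <- cons_tuple (t, r)) centered x))%:E)%E.
  apply: integral_ge0 => r _; rewrite lee_fin; apply: potential_ge0.
  by rewrite linearD /= map_mxD hS sum_centered_herm.
have intW : nu.-integrable setT (fun t => (k1 + Re (\tr (W' * outer (y t))))%:E).
  have := integrableD measurableT (finite_measure_integrable_cst nu k1 measurableT)
    (mean_int W').
  by apply: eq_integrable.
apply: (@le_trans _ _ (\int[nu]_t (k1 + Re (\tr (W' * outer (y t))))%:E)%E).
  apply: ge0_le_integral => //.
  - apply: (measurable_fun_fubini_tonelli_F
      (fun z => (potential (S + \sum_(x <- cons_tuple z) centered x))%:E)) => /=.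
      apply/measurable_EFinP.
      apply: (@measurableT_comp _ _ _ _ _ _ (fun t : k.+1.-tuple T =>
        potential (S + \sum_(x <- t) centered x)) _ (@cons_tuple _ T k)).
        exact: measurable_potential_sum.
      exact: measurable_cons_tuple.
    move=> z; rewrite lee_fin; apply: potential_ge0.
    by rewrite linearD /= map_mxD hS sum_centered_herm.
  - exact: measurable_int intW.
under eq_integral do rewrite EFinD.
rewrite integralD//; last exact: finite_measure_integrable_cst.
rewrite integral_cst// [X in (_ * X + _)%E](_ : _ = 1%E); last first.
  exact: (probability_setT nu).
rewrite mule1 mean -EFinD lee_fin W'E /k1 /budget -/M.
have := ler_wpM2l Gk0 H2; rewrite exprSr -[(1 + gain) ^+ k]/Gk.
have := gain_ge0; set g := gain; set err := trotter_error N c => g0.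
have err0 : 0 <= err by exact: trotter_error_ge0.
have : 0 <= k.+1%:R * (Gk * (g * err)).
  by apply: mulr_ge0 => //; apply: mulr_ge0 => //; exact: mulr_ge0.
rewrite -natr1; move: (k%:R : R) => q; lra.
Qed.

Lemma potential0 : potential 0 = 0.
Proof. by rewrite /potential /excess /compound scaler0 addr0 expr1n subrr subr0 mxtrace0. Qed.

Lemma potential_tail k (h : R) : 0 <= c1 -> k%:R * c1 <= c -> 0 < h ->
  (iid_law nu k [set t : k.-tuple T | (h <= potential (\sum_(x <- t) centered x))%R] <=
   (budget k / h)%:E)%E.
Proof.
move=> c10 kc h0.
have c0 : 0 <= c by apply: le_trans kc; rewrite mulr_ge0.
have h00 : (0 : 'M[C]_n)^t* = 0 by rewrite linear0 /= map_mx0.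
have Sc : norm1 (0 : 'M[C]_n) + (k%:R * c1)%:C%C <= c%:C%C.
  rewrite /norm1 big1 ?add0r ?lecR// => i _.
  by rewrite big1// => j _; rewrite mxE normr0.
have Ef := @expected_potential_le k 0 h00 c10 c0 Sc.
rewrite (_ : [set _ | _] =
  [set t : k.-tuple T | (h <= potential (0 + \sum_(x <- t) centered x))%R]); last first.
  by apply/seteqP; split => t /=; rewrite add0r.
have f0 (t : k.-tuple T) : 0 <= potential (0 + \sum_(x <- t) centered x).
  apply: potential_ge0; rewrite linearD /= map_mxD h00.
  by rewrite sum_centered_herm.
apply: (@markov_ge0 _ _ R (iid_law nu k) _ h (budget k)
  (@measurable_potential_sum k 0) f0 h0).
by move: Ef; rewrite potential0 mulr0 add0r mul0r mxtrace0 /= mulr0 addr0.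
Qed.

End iid_moment.

(** * The matrix Chernoff bound *)

Lemma mxtrace_outer_mul (C : numClosedFieldType) n (v : 'cV[C]_n) (B : 'M[C]_n) :
  \tr (outer v * B) = qform B v.
Proof.
by rewrite /outer -mulmxE -mulmxA mxtrace_mulC /qform /mxtrace big_ord1.
Qed.

(** The bad event is that the potential of the whole sum reaches its value at
    the threshold |a| eps.  Outside of it [qform_le_of_excess] bounds the sum,
    and [potential_tail] bounds its probability. *)
Lemma one_sided_chernoff d (T : measurableType d) (R : realType) (nu : probability T R)
    (n s : nat) (y : T -> 'cV[R[i]]_n) (K : 'M[R[i]]_n) (L eps dl a : R) :
  let sl := Re (\tr ((s%:R)%:C%C *: K)) in
  (0 < s)%N -> mxmeasurable setT y -> (forall t, qform 1 (y t) <= L%:C%C) -> 0 < L ->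
  K^t* = K -> psd K -> psd ((1 : 'M[R[i]]_n) - (s%:R)%:C%C *: K) ->
  (forall i j, cintegrable nu setT (fun t => outer (y t) i j)) ->
  (forall i j, cintegral nu setT (fun t => outer (y t) i j) = K i j) ->
  0 < eps -> eps <= 1 / 2 -> 0 < dl -> dl < 1 -> 1 / 2 <= sl ->
  8 / 3 * L * eps ^- 2 * ln (16 * sl / dl) <= 1 ->
  `|a| = 3 / 4 * eps / L ->
  exists B : set (s.-tuple T), [/\ measurable B, (iid_law nu s B <= (dl / 2)%:E)%E &
    forall t, ~ B t -> forall v,
      qform (\sum_(x <- t) centered y K a x) v <= (`|a| * eps)%:C%C * qform 1 v].
Proof.
move=> sl s0 my yL L0 hK pK K1 Yint Ymean eps0 eps2 dl0 dl1 sl2 lnle aE.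
have meanC W := cintegral_mxtrace measurableT W Yint Ymean.
have mean_int (W : 'M[R[i]]_n) : nu.-integrable setT (fun t => (Re (\tr (W * outer (y t))))%:E).
  by have [[]] := meanC W.
have mean (W : 'M[R[i]]_n) :
    (\int[nu]_t (Re (\tr (W * outer (y t))))%:E = (Re (\tr (W * K)))%:E)%E.
  have [_ <-] := meanC W; rewrite Re_cintegral /Rintegral fineK//.
  exact: integrable_fin_num.
(* K is an average of matrices outer (y t), each of which is at most L. *)
have KL : psd (L%:C%C *: (1 : 'M[R[i]]_n) - K).
  move=> v; rewrite qformB qformZ subr_ge0 -!mxtrace_outer_mul.
  rewrite -[leLHS]RRe_real; last by rewrite mxtrace_outer_mul ger0_real.
  rewrite -[\tr (outer v * 1)]RRe_real; last first.
    by rewrite mxtrace_outer_mul ger0_real// qform1_ge0.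
  rewrite -rmorphM lecR -lee_fin -mean.
  move Eq : (Re (\tr (outer v * 1))) => q.
  rewrite -[leRHS]mule1 -(probability_setT nu) -integral_cst//.
  apply: ge0_le_integral => //.
  - move=> t _; rewrite lee_fin mxtrace_outer_mul qform_outer.
    by apply: (@ler_Re _ 0); rewrite exprn_ge0.
  - exact: measurable_int (mean_int _).
  - move=> t _; rewrite /cst lee_fin -Eq -cReZ; apply: ler_Re.
    rewrite !mxtrace_outer_mul; apply: le_trans (qform_outer_le _ _) _.
    by rewrite ler_wpM2r ?qform1_ge0.
have La : `|a| * L <= 1 / 2.
  by rewrite aE divfK ?gt_eqF//; lra.
(* c1 bounds the entrywise norm of one summand, c that of all partial sums. *)
pose c1 : R := `|a| * (n%:R * (n%:R * L) + Re (norm1 K)).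
have nK0 : 0 <= Re (norm1 K) by apply: (@ler_Re _ 0); exact: norm1_ge0.
have c10 : 0 <= c1 by rewrite mulr_ge0// addr_ge0// !mulr_ge0// ltW.
have Zc (y' : 'cV[R[i]]_n) : qform 1 y' <= L%:C%C ->
    norm1 (a%:C%C *: (outer y' - K)) <= c1%:C%C.
  move=> y'L; rewrite norm1Z.
  have -> : `|a%:C%C : R[i]| = (`|a|)%:C%C.
    by rewrite normc_def /= expr0n addr0 sqrtr_sqr.
  rewrite /c1 rmorphM ler_wpM2l ?ler0c//.
  apply: le_trans (norm1D _ _) _; rewrite rmorphD lerD//; last first.
    rewrite norm1N /= RRe_real//.
    by rewrite ger0_real// norm1_ge0.
  apply: le_trans (norm1_outer _) _.
  by rewrite !rmorphM !rmorph_nat !ler_wpM2l.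
pose c := s%:R * c1.
have c0 : 0 <= c by rewrite mulr_ge0.
(* With |a| = (3/4) eps / L the threshold |a| eps is (3/4) eps^2 / L, and the
   growth s (2/3) a^2 L / s of the potential uses up half of it in the
   exponent. *)
pose y0 : R := `|a| * eps.
have y00 : 0 <= y0 by rewrite mulr_ge0// ltW.
have sl0 : 0 < sl by lra.
have [m [err_small cmp_large]] := @exists_fine_compound R y0 c sl s%:R y00 c0 sl0 (ler0n _ _).
set N := (2 ^ m.+1)%N in err_small cmp_large.
have y0E : y0 = 3 / 4 * (eps ^+ 2 / L) by rewrite /y0 aE; field; rewrite gt_eqF.
have ln_le : ln (16 * sl / dl) <= y0 / 2.
  have e2 : 0 < eps ^+ 2 by rewrite exprn_gt0.
  have Le : 0 < 3 / 8 * (eps ^+ 2 / L) by rewrite mulr_gt0// divr_gt0.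
  have := ler_wpM2l (ltW Le) lnle; rewrite mulr1 y0E.
  set ell := ln _; set r := eps ^+ 2 / L.
  have -> : 3 / 8 * r * (8 / 3 * L * eps ^- 2 * ell) = ell.
    by rewrite /r; field; rewrite !gt_eqF.
  lra.
have [num h0] := tail_numerics dl0 dl1 sl2 ln_le cmp_large.
set h := _ - y0 in num h0.
have s0' : 0 < s%:R :> R by rewrite ltr0n.
exists [set t : s.-tuple T | (h <= potential m (\sum_(x <- t) centered y K a x))%R]; split.
- apply: measurable_ge_level.
  by have := @measurable_potential_sum _ T R n m y K a my s 0;
     under eq_fun do rewrite add0r.
- have := @potential_tail _ T R nu n m y K L s%:R a c1 c my yL hK pK KL K1 (ltW L0) s0'
    La Zc mean_int mean s h c10 (lexx _) h0.
  move=> /le_trans; apply; rewrite lee_fin ler_pdivrMr//.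
  apply: le_trans num.
  set g := gain L s%:R a.
  have g0 : 0 <= g by exact: gain_ge0 (ltW L0) s0'.
  have Gle : (1 + g) ^+ s <= expR (y0 / 2).
    apply: le_trans (compound_le_expR _ g0) _; rewrite ler_expR.
    rewrite le_eqVlt; apply/orP; left; apply/eqP.
    rewrite /g /gain -(real_normK (num_real a)) y0E aE; field.
    by rewrite !gt_eqF.
  apply: (@le_trans _ _ ((1 + g) ^+ s * (2 * sl))); last first.
    by rewrite ler_wpM2r// mulr_ge0// ltW.
  have G0 : 0 <= (1 + g) ^+ s by rewrite exprn_ge0// addr_ge0.
  have := ler_wpM2l G0 err_small.
  rewrite /budget -/sl -/g -/N; move: (trotter_error N c) => err; lra.
- move=> t /negP; rewrite -ltNge => th v.
  have hS := sum_centered_herm y a hK t.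
  have ex0 := excess_mul_psd_ge0 (exp2S_gt0 m) (exp2S_even m) hS (@psd1 R n).
  rewrite mulr1 in ex0.
  apply: (qform_le_of_excess (exp2S_gt0 m) (exp2S_even m) hS y00).
  by rewrite -[ltLHS]RRe_real ?ger0_real// ltcR.
Qed.

Lemma qform_sum_centered (T : Type) (R : rcfType) n (y : T -> 'cV[R[i]]_n) K a (r : seq T) v :
  qform (\sum_(x <- r) a%:C%C *: (outer (y x) - K)) v =
  a%:C%C * (qform (\sum_(x <- r) outer (y x)) v - (size r)%:R * qform K v).
Proof.
elim: r => [|x r IH].
  by rewrite !big_nil /qform mulmx0 mul0mx mxE mul0r subr0 mulr0.
rewrite !big_cons !qformD IH qformZ qformB /= -natr1; ring.
Qed.

(** Concentration of a sum of s independent rank-one matrices with a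
    prefactor that depends on the trace of the mean only.  The two signs of the
    scaling a give the two sides, each with half of the failure probability. *)
Theorem matrix_chernoff d (T : measurableType d) (R : realType) (nu : probability T R)
    (n s : nat) (y : T -> 'cV[R[i]]_n) (K : 'M[R[i]]_n) (L eps dl : R) :
  let sl := Re (\tr ((s%:R)%:C%C *: K)) in
  (0 < s)%N -> mxmeasurable setT y -> (forall t, qform 1 (y t) <= L%:C%C) -> 0 < L ->
  K^t* = K -> psd K -> psd ((1 : 'M[R[i]]_n) - (s%:R)%:C%C *: K) ->
  (forall i j, cintegrable nu setT (fun t => outer (y t) i j)) ->
  (forall i j, cintegral nu setT (fun t => outer (y t) i j) = K i j) ->
  0 < eps -> eps <= 1 / 2 -> 0 < dl -> dl < 1 -> 1 / 2 <= sl ->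
  8 / 3 * L * eps ^- 2 * ln (16 * sl / dl) <= 1 ->
  exists B : set (s.-tuple T), [/\ measurable B, (iid_law nu s B <= dl%:E)%E &
    forall t, ~ B t -> forall v,
      `|qform (\sum_(x <- t) outer (y x)) v - s%:R * qform K v| <= eps%:C%C * qform 1 v].
Proof.
move=> sl s0 my yL L0 hK pK K1 Yint Ymean eps0 eps2 dl0 dl1 sl2 lnle.
pose th : R := 3 / 4 * eps / L.
have th0 : 0 < th by rewrite /th divr_gt0// mulr_gt0.
have thE : `|th| = 3 / 4 * eps / L by rewrite gtr0_norm.
have [B1 [mB1 B1le B1P]] := one_sided_chernoff s0 my yL L0 hK pK K1 Yint Ymean
  eps0 eps2 dl0 dl1 sl2 lnle thE.
have [|B2 [mB2 B2le B2P]] := one_sided_chernoff (a := - th) s0 my yL L0 hK pK K1 Yint Ymean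
  eps0 eps2 dl0 dl1 sl2 lnle; first by rewrite normrN.
exists (B1 `|` B2); split; first exact: measurableU.
  apply: le_trans (measureU2 _ _ _) _ => //.
  apply: le_trans (leeD B1le B2le) _.
  by rewrite -EFinD lee_fin -splitr.
move=> t /not_orP[nB1 nB2] v.
have := B1P t nB1 v; have := B2P t nB2 v.
rewrite /centered !qform_sum_centered size_tuple normrN (gtr0_norm th0).
set q := qform _ v - _; set e := eps%:C%C.
have th0' : 0 < th%:C%C :> R[i] by rewrite ltcR.
rewrite rmorphM rmorphN mulNr -mulrN -!mulrA !ler_pM2l// => h2 h1.
have rq : q \is Num.real.
  rewrite (ler_real h1) ger0_real// mulr_ge0 ?qform1_ge0//.
  by rewrite ler0c ltW.
by rewrite real_ler_norml// h1 andbT lerNl.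
Qed.

(** * Integration against a density *)

Section density.
Context d (T : measurableType d) (R : realType).
Variables (leb nu : {measure set T -> \bar R}).

Section nonneg.
Variable g : T -> R.
Hypotheses (mg : measurable_fun setT g) (g0 : forall t, 0 <= g t).
Hypothesis nu_g : forall B, measurable B -> nu B = (\int[leb]_(t in B) (g t)%:E)%E.
Local Open Scope ereal_scope.

Import HBNNSimple.

(** True for indicators by definition of the density, hence for simple
    functions, hence for their monotone limits. *)
Lemma ge0_integral_density (f : T -> R) E : (forall x, (0 <= f x)%R) ->
    measurable E -> measurable_fun E f ->
  \int[nu]_(x in E) (f x)%:E = \int[leb]_(x in E) (f x * g x)%:E.
Proof.
move=> f0 mE /measurable_EFinP mf; apply/esym.
pose h := nnsfun_approx mE mf.
have -> : \int[nu]_(x in E) (f x)%:E =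
    lim (\int[nu]_(x in E) (EFin \o h n) x @[n --> \oo]).
  have fE x : E x -> (f x)%:E = lim ((EFin \o h n) x @[n --> \oo]).
    by move=> Ex; apply/esym/cvg_lim => //; apply: cvg_nnsfun_approx => // t _; rewrite /= lee_fin.
  under eq_integral => x /[!inE] /fE -> //.
  apply: monotone_convergence => //.
  - move=> n; apply/measurable_EFinP.
    by apply: (measurable_funS measurableT) => //; exact/measurable_funP.
  - by move=> n x Ex //=; rewrite lee_fin.
  - by move=> x Ex a b ab; rewrite lee_fin; exact/lefP/nd_nnsfun_approx.
have -> : \int[leb]_(x in E) (f x * g x)%:E =
    lim (\int[leb]_(x in E) (h n x * g x)%:E @[n --> \oo]).
  have fg x : E x -> (f x * g x)%:E = lim ((h n x * g x)%:E @[n --> \oo]).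
    move=> Ex; apply/esym/cvg_lim => //; rewrite EFinM; under eq_fun do rewrite EFinM.
    by apply: cvgeZr => //; apply: cvg_nnsfun_approx => // t _; rewrite /= lee_fin.
  under eq_integral => x /[!inE] /fg -> //.
  apply: monotone_convergence => [//| | |].
  - move=> n; apply/measurable_EFinP/measurable_funM; apply/measurable_funTS => //.
  - by move=> n x Ex /=; rewrite lee_fin mulr_ge0.
  - by move=> x Ex a b ab/=; rewrite lee_fin ler_wpM2r//; exact/lefP/nd_nnsfun_approx.
suff suf n : \int[leb]_(x in E) (h n x * g x)%:E = \int[nu]_(x in E) (EFin \o h n) x.
  by under eq_fun do rewrite suf.
transitivity (\int[nu]_(x in E)
   (\sum_(y \in range (h n)) (y * \1_(h n @^-1` [set y]) x)%:E)); last first.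
  by apply: eq_integral => t tE; rewrite /= fimfunE -fsumEFin.
have indich m r : measurable_fun E (fun x => (r * \1_(h m @^-1` [set r]) x)%:E).
  by apply: (measurable_comp measurableT) => //; exact: measurable_funM.
rewrite ge0_integral_fsum//; last by move=> m y Ey; exact: nnfun_muleindic_ge0.
transitivity (\int[leb]_(x in E) (\sum_(y \in range (h n))
    (y * \1_(h n @^-1` [set y]) x)%:E * (g x)%:E)).
  under [RHS]eq_integral => x xE.
    rewrite -ge0_mule_fsuml => [|y]; last exact: nnfun_muleindic_ge0.
    rewrite fsumEFin // -(fimfunE _ x) -EFinM; over.
  by [].
have mgE : measurable_fun E (EFin \o g).
  by apply/measurable_EFinP; exact: measurable_funTS.
rewrite ge0_integral_fsum//; last 2 first.
  - by move=> y; apply: emeasurable_funM.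
  - by move=> m y Ey; apply: mule_ge0; [exact: nnfun_muleindic_ge0|rewrite lee_fin].
apply: eq_fsbigr => r rhn.
under [RHS]eq_integral do rewrite EFinM.
rewrite integralZl_indic_nnsfun => //.
under eq_integral do rewrite EFinM -muleA.
rewrite ge0_integralZl//.
- under eq_integral do rewrite muleC.
  rewrite (eq_integral ((EFin \o g) \_ (h n @^-1` [set r]))); last first.
    by move=> x xE; rewrite epatch_indic.
  rewrite -integral_mkcondr integral_indic//.
  have mhr : measurable (h n @^-1` [set r]) by exact: measurable_funPTI.
  by rewrite setIC nu_g//; exact: measurableI.
- by apply: emeasurable_funM => //; exact/measurable_EFinP.
- by move=> t Et; rewrite mule_ge0 ?lee_fin.
- by move: rhn; rewrite inE => -[t _ <-]; rewrite lee_fin.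
Qed.

End nonneg.
Variables (Omega : set T) (q : T -> R).
Hypotheses (mOmega : measurable Omega) (nu_q : has_density leb Omega nu q).

Lemma ge0_integral_has_density (f : T -> R) : (forall x, 0 <= f x) ->
  measurable_fun Omega f ->
  (\int[nu]_(x in Omega) (f x)%:E = \int[leb]_(x in Omega) (f x * q x)%:E)%E.
Proof.
move=> f0 mf; have [mq q0 nuE] := nu_q.
rewrite (@ge0_integral_density (q \_ Omega) _ _ _ f)//.
- apply: eq_integral => t; rewrite inE => Ot; rewrite patchE mem_set//.
- by apply/(measurable_restrictT _ mOmega).
- by move=> t; rewrite patchE; case: ifPn => // /set_mem /q0.
- move=> B mB; rewrite nuE// integral_mkcondl; apply: eq_integral => t _.
  by rewrite !patchE; case: ifP.
Qed.

Lemma integral_has_density (f : T -> R) : measurable_fun Omega f ->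
  (\int[nu]_(x in Omega) (f x)%:E = \int[leb]_(x in Omega) (f x * q x)%:E)%E.
Proof.
move=> mf; have [mq q0 nuE] := nu_q.
rewrite [LHS]integralE [RHS]integralE; congr (_ - _)%E.
- transitivity (\int[nu]_(x in Omega) (f^\+ x)%:E)%E.
    by rewrite (funerpos f).
  rewrite ge0_integral_has_density//; last exact: measurable_funrpos.
  rewrite (funerpos (fun x => f x * q x)).
  apply: eq_integral => t; rewrite inE => Ot /=; congr (_%:E).
  by rewrite /funrpos maxr_pMl ?q0// mul0r.
- transitivity (\int[nu]_(x in Omega) (f^\- x)%:E)%E.
    by rewrite (funerneg f).
  rewrite ge0_integral_has_density//; last exact: measurable_funrneg.
  rewrite (funerneg (fun x => f x * q x)).
  apply: eq_integral => t; rewrite inE => Ot /=; congr (_%:E).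
  by rewrite /funrneg maxr_pMl ?q0// mulNr mul0r.
Qed.

Lemma integrable_has_density (f : T -> R) : measurable_fun Omega f ->
  nu.-integrable Omega (EFin \o f) <->
  leb.-integrable Omega (EFin \o (fun t => f t * q t)).
Proof.
move=> mf; have [mq q0 _] := nu_q.
have E : (\int[nu]_(x in Omega) `|(f x)%:E| = \int[leb]_(x in Omega) `|(f x * q x)%:E|)%E.
  transitivity (\int[nu]_(x in Omega) (`|f x|)%:E)%E; first by [].
  rewrite ge0_integral_has_density//; last exact: measurableT_comp.
  apply: eq_integral => t; rewrite inE => Ot.
  by rewrite /= normrM (ger0_norm (q0 _ Ot)).
split=> /integrableP[_ fin]; apply/integrableP; split.
- by apply/measurable_EFinP; exact: measurable_funM.
- by rewrite -E.
- exact/measurable_EFinP.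
- by rewrite /= E.
Qed.

Lemma cintegrable_has_density f : cmeasurable Omega f ->
  cintegrable nu Omega f <-> cintegrable leb Omega (fun t => (q t)%:C%C * f t).
Proof.
move=> [m1 m2]; have I1 := integrable_has_density m1; have I2 := integrable_has_density m2.
rewrite /cintegrable (_ : EFin \o (fun t => Re ((q t)%:C%C * f t)) =
    EFin \o (fun t => Re (f t) * q t)); last first.
  by apply/funext => t /=; rewrite cReZ mulrC.
rewrite (_ : EFin \o (fun t => Im ((q t)%:C%C * f t)) =
    EFin \o (fun t => Im (f t) * q t)); last first.
  by apply/funext => t /=; rewrite cImM /= mul0r addr0 mulrC.
by split=> -[/I1 ? /I2 ?].
Qed.

Lemma cintegral_has_density f : cmeasurable Omega f ->
  cintegral nu Omega f = cintegral leb Omega (fun t => (q t)%:C%C * f t).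
Proof.
move=> [m1 m2]; apply: eq_complex_parts; rewrite /= /Rintegral.
  rewrite integral_has_density//; congr fine; apply: eq_integral => t _.
  by rewrite cReZ mulrC.
rewrite integral_has_density//; congr fine; apply: eq_integral => t _.
by rewrite cImM /= mul0r addr0 mulrC.
Qed.

End density.

(** * Gram matrices in L2 *)

Section L2_theory.
Context d (T : measurableType d) (R : realType).
Variables (mu : {measure set T -> \bar R}) (D : set T).
Hypothesis mD : measurable D.
Implicit Types f g : T -> R[i].

Lemma normc_sqr (z : R[i]) : Normc.normc z ^+ 2 = Re z ^+ 2 + Im z ^+ 2.
Proof. by case: z => a b /=; rewrite sqr_sqrtr// addr_ge0 ?sqr_ge0. Qed.

Lemma L2_fun_integrable f : L2_fun mu D f ->
  mu.-integrable D (EFin \o (fun t => Re (f t) ^+ 2 + Im (f t) ^+ 2)).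
Proof.
move=> [[m1 m2] fin]; apply/integrableP; split.
  by apply/measurable_EFinP; apply: measurable_funD; exact: measurable_funX.
apply: le_lt_trans fin; rewrite le_eqVlt; apply/orP; left; apply/eqP.
apply: eq_integral => t _; rewrite normc_sqr /= ger0_norm//.
by rewrite addr_ge0 ?sqr_ge0.
Qed.

Lemma L2_fun_conj f : L2_fun mu D f -> L2_fun mu D (fun t => (f t)^*).
Proof.
move=> [mf fin]; split; first exact: cmeasurable_conj.
apply: le_lt_trans fin; rewrite le_eqVlt; apply/orP; left; apply/eqP.
by apply: eq_integral => t _; rewrite !normc_sqr cRe_conj cIm_conj sqrrN.
Qed.

Lemma cross_bound (a b a' b' : R) :
  `|a * a' - b * b'| <= a ^+ 2 + b ^+ 2 + (a' ^+ 2 + b' ^+ 2).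
Proof.
have := sqr_ge0 (a - a'); have := sqr_ge0 (a + a').
have := sqr_ge0 (b - b'); have := sqr_ge0 (b + b').
have := sqr_ge0 a; have := sqr_ge0 b; have := sqr_ge0 a'; have := sqr_ge0 b'.
rewrite !sqrrD !sqrrN ler_norml => *; apply/andP; split; lra.
Qed.

Lemma L2_fun_mul_cintegrable f g : L2_fun mu D f -> L2_fun mu D g ->
  cintegrable mu D (fun t => f t * g t).
Proof.
move=> Lf Lg; have [mf _] := Lf; have [mg _] := Lg.
have [m1 m2] := cmeasurableM mf mg.
have Ifg := integrableD_EFin mD (L2_fun_integrable Lf) (L2_fun_integrable Lg).
split.
  apply: (le_integrable mD _ _ Ifg); first exact/measurable_EFinP.
  move=> t _; rewrite /= lee_fin cReM [leRHS]ger0_norm ?addr_ge0 ?sqr_ge0//.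
  exact: cross_bound.
apply: (le_integrable mD _ _ Ifg); first exact/measurable_EFinP.
move=> t _; rewrite /= lee_fin cImM [leRHS]ger0_norm ?addr_ge0 ?sqr_ge0//.
have := cross_bound (Re (f t)) (Im (f t)) (Im (g t)) (- Re (g t)).
by rewrite mulrN opprK sqrrN (addrC (Im (g t) ^+ 2)).
Qed.

Lemma ae_eq_cintegral f g : cmeasurable D f -> cmeasurable D g -> L2_eq mu D f g ->
  cintegral mu D f = cintegral mu D g.
Proof.
move=> [f1 f2] [g1 g2] fg; apply: eq_complex_parts; rewrite /= /Rintegral; congr fine.
  apply: ae_eq_integral => //; [exact/measurable_EFinP|exact/measurable_EFinP|].
  by apply: filterS fg => t fgt Dt /=; rewrite fgt.
apply: ae_eq_integral => //; [exact/measurable_EFinP|exact/measurable_EFinP|].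
by apply: filterS fg => t fgt Dt /=; rewrite fgt.
Qed.

Section gram.
Context (m : nat) (F : 'I_m -> T -> R[i]).
Hypothesis LF : quasimatrix mu D F.

Lemma gram_cintegrable i j : cintegrable mu D (fun t => (F i t)^* * F j t).
Proof. by apply: L2_fun_mul_cintegrable => //; exact: L2_fun_conj. Qed.

(** Sesquilinearity of the integral, which needs the products of the columns
    to be integrable. *)
Lemma L2_inner_qapply (y : 'cV[R[i]]_m) :
  L2_inner mu D (qapply F y) (qapply F y) = qform (gram mu D F) y.
Proof.
rewrite /L2_inner (@eq_cintegral _ _ _ mu D _ (fun t =>
    \sum_i \sum_j (y i 0)^* * y j 0 * ((F i t)^* * F j t))); last first.
  move=> t _; rewrite /qapply rmorph_sum mulr_suml; apply: eq_bigr => i _.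
  rewrite mulr_sumr; apply: eq_bigr => j _; rewrite rmorphM; ring.
have I1 i j := cintegrableZ mD ((y i 0)^* * y j 0) (gram_cintegrable i j).
rewrite cintegral_sum//; last by move=> i; exact: cintegrable_sum.
rewrite /qform mxE.
under [RHS]eq_bigr do rewrite mxE mulr_suml.
rewrite exchange_big; apply: eq_bigr => i _.
rewrite cintegral_sum//; apply: eq_bigr => j _.
rewrite cintegralZ//; last exact: gram_cintegrable.
by rewrite !mxE mulrAC.
Qed.

Lemma L2_inner_ge0 f : 0 <= L2_inner mu D f f.
Proof.
have E t : (f t)^* * f t = (Re (f t) ^+ 2 + Im (f t) ^+ 2)%:C%C.
  by apply: eq_complex_parts; rewrite ?cReM ?cImM cRe_conj cIm_conj /=; ring.
rewrite /L2_inner lecE; apply/andP; split.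
  rewrite /= /Rintegral (eq_integral (cst 0)) ?integral0// => t _.
  by rewrite E.
rewrite /=; apply: Rintegral_ge0 => t _; rewrite E /=.
by rewrite addr_ge0 ?sqr_ge0.
Qed.

Lemma gram_psd : psd (gram mu D F).
Proof. by move=> y; rewrite -L2_inner_qapply; exact: L2_inner_ge0. Qed.

Lemma L2_norm_qapply (y : 'cV[R[i]]_m) :
  (L2_norm mu D (qapply F y) ^+ 2)%:C%C = qform (gram mu D F) y.
Proof.
rewrite -L2_inner_qapply /L2_norm sqr_sqrtr; last first.
  by have /ler_Re := L2_inner_ge0 (qapply F y).
by rewrite RRe_real// ger0_real// L2_inner_ge0.
Qed.

Lemma gram_herm : (gram mu D F)^t* = gram mu D F.
Proof.
apply/matrixP => i j; rewrite !mxE; apply: eq_complex_parts.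
  rewrite cRe_conj /=; apply: eq_Rintegral => t _.
  by rewrite !cReM !cRe_conj !cIm_conj; ring.
rewrite cIm_conj /= -mulN1r -RintegralZl//; last first.
  by have [_] := gram_cintegrable j i.
apply: eq_Rintegral => t _.
by rewrite !cImM !cRe_conj !cIm_conj; ring.
Qed.

(** Column i is the conjugate of z_i almost everywhere, so conj(A_i) A_j is
    z_i conj(z_j), the entry of the rank-one matrix of z. *)
Lemma gram_coord (z : T -> 'cV[R[i]]_m) :
  (forall i, L2_fun mu D (fun t => z t i 0)) ->
  (forall i, L2_eq mu D (F i) (fun t => (z t i 0)^*)) ->
  forall i j, cintegrable mu D (fun t => outer (z t) i j) /\
    cintegral mu D (fun t => outer (z t) i j) = gram mu D F i j.
Proof.
move=> Lz Fz i j.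
have oE t : outer (z t) i j = z t i 0 * (z t j 0)^*.
  by rewrite mxE big_ord1 !mxE.
have Io : cintegrable mu D (fun t => outer (z t) i j).
  under eq_fun do rewrite oE.
  by apply: L2_fun_mul_cintegrable => //; exact: L2_fun_conj.
split => //; rewrite mxE /L2_inner; apply: ae_eq_cintegral.
- by case: Io => /measurable_int/measurable_EFinP ? /measurable_int/measurable_EFinP ?.
- have [] := gram_cintegrable i j.
  by move=> /measurable_int/measurable_EFinP ? /measurable_int/measurable_EFinP ?.
- have Fi := Fz i; have Fj := Fz j; rewrite /L2_eq in Fi Fj *.
  near=> t => Dt; rewrite oE.
  have -> : F i t = (z t i 0)^* by move: Dt; near: t.
  have -> : F j t = (z t j 0)^* by move: Dt; near: t.
  by rewrite conjCK.
Unshelve. all: by end_near.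
Qed.

End gram.

End L2_theory.

(** * Whitening a Gram matrix *)

Section unitary_diag.
Context {C : numClosedFieldType} {m : nat}.
Variable U : 'M[C]_m.
Hypothesis UU : U \is unitarymx.

Lemma udiag_unit (e : 'I_m -> C) : udiag U e \in unitmx -> forall i, e i != 0.
Proof.
rewrite unitmxE unitfE /udiag !det_mulmx det_diag => det0 i.
apply/negP => /eqP ei; move/negP: det0; apply; apply/eqP.
by rewrite (bigD1 i)//= mxE ei mul0r mulr0 mul0r.
Qed.

Lemma invmx_udiag (e : 'I_m -> C) : (forall i, e i != 0) ->
  invmx (udiag U e) = udiag U (fun i => (e i)^-1).
Proof.
move=> e0; have E : udiag U e *m udiag U (fun i => (e i)^-1) = 1%:M.
  rewrite mulmxE udiagM// -[RHS](udiag1 UU).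
  by congr (udiag U _); apply/funext => i; rewrite divff.
have [u _] := mulmx1_unit E.
by rewrite -[RHS](mulKmx u) E mulmx1.
Qed.

End unitary_diag.

Lemma vnorm2_sqr (R : realType) n (x : 'cV[R[i]]_n) : (vnorm2 x ^+ 2)%:C%C = qform 1 x.
Proof.
rewrite /vnorm2 sqr_sqrtr; last by apply: sumr_ge0 => i _; exact: sqr_ge0.
rewrite qform1 rmorph_sum; apply: eq_bigr => i _.
by rewrite normc_sqr -add_Re2_Im2.
Qed.

Lemma conj_real_complex (R : rcfType) (a : R) : (a%:C%C)^* = a%:C%C.
Proof. by apply/CrealP; exact: real_complex_is_real. Qed.

Lemma udiag_herm (R : rcfType) m (U : 'M[R[i]]_m) (e : 'I_m -> R) :
  (udiag U (fun i => (e i)%:C%C))^t* = udiag U (fun i => (e i)%:C%C).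
Proof.
rewrite /udiag !trmx_mul !map_mxM trmxCK mulmxA; congr (_ *m _ *m _).
apply/matrixP => i j; rewrite !mxE eq_sym; have [->|_] := eqVneq i j; last first.
  by rewrite !mulr0n rmorph0.
by rewrite !mulr1n; exact: conj_real_complex.
Qed.

Section whitening.
Context {R : realType} {m : nat}.
Local Notation C := R[i].
Variables (G U : 'M[C]_m) (g : 'I_m -> R) (lambda : R).
Hypotheses (UU : U \is unitarymx) (GE : G = udiag U (fun i => (g i)%:C%C)).
Hypotheses (pG : psd G) (l0 : 0 <= lambda) (Gu : G + (lambda%:C)%C%:M \in unitmx).

Lemma eigen_ge0 i : 0 <= g i.
Proof. by rewrite -ler0c -(qform_udiag_col UU (fun i => (g i)%:C%C)) -GE. Qed.

Lemma shifted_udiag : G + (lambda%:C)%C%:M = udiag U (fun i => (g i + lambda)%:C%C).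
Proof.
have -> : (lambda%:C)%C%:M = (lambda%:C)%C *: udiag U (fun=> 1) :> 'M[C]_m.
  by rewrite udiag1// scalemx1.
rewrite GE udiagZ udiagD; congr (udiag U _); apply/funext => i.
by rewrite mulr1 rmorphD.
Qed.

Lemma shifted_eigen_gt0 i : 0 < g i + lambda.
Proof.
have := Gu; rewrite shifted_udiag => /(udiag_unit)/(_ i).
rewrite -(rmorph0 (real_complex R)) (inj_eq (@complexI R)) => n0.
by rewrite lt_def n0 addr_ge0// eigen_ge0.
Qed.

Lemma invmx_shifted :
  invmx (G + (lambda%:C)%C%:M) = udiag U (fun i => ((g i + lambda)^-1)%:C%C).
Proof.
have e0 i : (g i + lambda)%:C%C != 0 :> C.
  rewrite -(rmorph0 (real_complex R)) (inj_eq (@complexI R)).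
  by rewrite gt_eqF// shifted_eigen_gt0.
rewrite shifted_udiag (invmx_udiag UU e0).
by congr (udiag U _); apply/funext => i; rewrite fmorphV.
Qed.

Lemma trace_invmx_shifted :
  \tr (invmx (G + (lambda%:C)%C%:M) *m G) = (\sum_i g i / (g i + lambda))%:C%C.
Proof.
rewrite invmx_shifted {1}GE mulmxE udiagM// mxtrace_udiag// rmorph_sum.
by apply: eq_bigr => i _; rewrite -rmorphM mulrC.
Qed.

(** A matrix T with T^H T = (G + lambda)^-1. *)
Definition whitener : 'M[C]_m :=
  diag_mx (\row_i ((Num.sqrt (g i + lambda))^-1)%:C%C) *m U.

(** The inverse of the adjoint of [whitener], by [adj_whitener_unwhiten]: the
    change of variables in the Hermitian forms. *)
Definition unwhiten (x : 'cV[C]_m) : 'cV[C]_m :=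
  diag_mx (\row_i (Num.sqrt (g i + lambda))%:C%C) *m (U *m x).

Lemma sqrt_gt0 i : 0 < Num.sqrt (g i + lambda).
Proof. by rewrite sqrtr_gt0 shifted_eigen_gt0. Qed.

Lemma normc_real_sqr (a : R) : `|a%:C%C : C| ^+ 2 = (a ^+ 2)%:C%C.
Proof. by rewrite -add_Re2_Im2 /= expr0n addr0. Qed.

Lemma qform1_whitener z :
  qform 1 (whitener *m z) = qform (invmx (G + (lambda%:C)%C%:M)) z.
Proof.
rewrite invmx_shifted qform_udiag qform1; apply: eq_bigr => i _.
rewrite /whitener -mulmxA mul_diag_mx !mxE normrM exprMn normc_real_sqr exprVn.
by rewrite sqr_sqrtr// ltW// shifted_eigen_gt0.
Qed.

Lemma adj_whitener_unwhiten x : whitener^t* *m unwhiten x = x.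
Proof.
have -> : whitener^t* *m unwhiten x = U^t* *m (U *m x).
  rewrite /whitener /unwhiten trmx_mul map_mxM -mulmxA; congr (_ *m _).
  rewrite mulmxA -[RHS]mul1mx; congr (_ *m _).
  apply/matrixP => i j; rewrite mul_mx_diag !mxE.
  have [_|ij] := eqVneq i j; last by rewrite !mulr0n rmorph0 mul0r.
  rewrite !mulr1n [X in X * _](conj_real_complex _).
  by rewrite -rmorphM mulVf ?rmorph1// gt_eqF// sqrt_gt0.
by rewrite mulmxA (mulmx1C (unitarymxP UU)) mul1mx.
Qed.

(** The Gram matrix in whitened coordinates, by [whitener_gram]. *)
Definition whitened_gram : 'M[C]_m := udiag 1 (fun i => (g i / (g i + lambda))%:C%C).

Lemma unitary1 : (1 : 'M[C]_m) \is unitarymx.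
Proof. by apply/unitarymxP; rewrite trmx1 map_mx1 mulmx1. Qed.

Lemma whitener_gram : whitener *m G *m whitener^t* = whitened_gram.
Proof.
rewrite /whitener GE /udiag trmx_mul map_mxM !mulmxA.
rewrite -(mulmxA _ U) (unitarymxP UU) mulmx1 -(mulmxA _ U) (unitarymxP UU) mulmx1.
rewrite /whitened_gram /udiag trmx1 map_mx1 mul1mx mulmx1.
apply/matrixP => i j; rewrite -mulmxA mul_diag_mx mul_diag_mx !mxE.
have [<-|ij] := eqVneq i j; last by rewrite !mulr0n rmorph0 !mulr0.
rewrite !mulr1n [X in _ * (_ * X)](conj_real_complex _) -!rmorphM; congr (_%:C%C).
have s1 := sqrt_gt0 i; have s2 := shifted_eigen_gt0 i.
have rE := sqr_sqrtr (ltW s2).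
move: s1 rE; set r := Num.sqrt _ => s1 <-; field.
by rewrite gt_eqF.
Qed.

Lemma qform_whitened_gram x : qform whitened_gram (unwhiten x) = qform G x.
Proof.
rewrite -[x in RHS]adj_whitener_unwhiten -whitener_gram /qform.
by rewrite (trmx_mul (whitener^t*)) map_mxM trmxCK !mulmxA.
Qed.

Lemma qform1_unwhiten x : qform 1 (unwhiten x) = qform (G + (lambda%:C)%C%:M) x.
Proof.
rewrite shifted_udiag qform_udiag qform1; apply: eq_bigr => i _.
rewrite /unwhiten mul_diag_mx !mxE normrM exprMn normc_real_sqr.
by rewrite sqr_sqrtr// ltW// shifted_eigen_gt0.
Qed.

Lemma whitened_gram_psd : psd whitened_gram.
Proof.
apply: psd_udiag => i.
by rewrite ler0c divr_ge0 ?eigen_ge0// ltW// shifted_eigen_gt0.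
Qed.

Lemma whitened_gram_le1 : psd ((1 : 'M[C]_m) - whitened_gram).
Proof.
rewrite /whitened_gram -{1}(udiag1 unitary1) udiagB.
apply: psd_udiag => i.
rewrite subr_ge0 -(rmorph1 (real_complex R)) lecR ler_pdivrMr ?shifted_eigen_gt0//.
by rewrite mul1r lerDl.
Qed.

Lemma trace_whitened_gram :
  \tr whitened_gram = (\sum_i g i / (g i + lambda))%:C%C.
Proof. by rewrite mxtrace_udiag ?unitary1// rmorph_sum. Qed.

Lemma whitened_gram_herm : whitened_gram^t* = whitened_gram.
Proof.
exact: udiag_herm.
Qed.

(** |Gx|^2 is the form of G^2 at x, whose eigenvalues are at most c^2. *)
Lemma mxnorm2_le (c : R) : (forall i, g i <= c) -> 0 <= c -> mxnorm2 G <= c.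
Proof.
move=> gc c0; apply: ge_sup; first by exists (vnorm2 (G *m 0)), 0 => //=;
  rewrite /vnorm2 big1 ?sqrtr0// => i _; rewrite mxE normc_sqr /= expr0n addr0.
move=> _ [x /= x1 <-].
have v0 (z : 'cV[C]_m) : 0 <= vnorm2 z by exact: sqrtr_ge0.
apply: (@le_trans _ _ (c * vnorm2 x)); last by rewrite ler_piMr.
rewrite -(@ler_pXn2r _ 2)// ?nnegrE ?mulr_ge0// -lecR exprMn vnorm2_sqr.
rewrite [leRHS]rmorphM /= vnorm2_sqr.
have -> : qform 1 (G *m x) = qform (udiag U (fun i => (g i ^+ 2)%:C%C)) x.
  have -> : udiag U (fun i => (g i ^+ 2)%:C%C) = G * G.
    rewrite GE (udiagM UU); congr (udiag U _); apply/funext => i.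
    by rewrite -rmorphM expr2.
  by rewrite /qform trmx_mul map_mxM mulmx1 GE udiag_herm -mulmxE !mulmxA.
apply: qform_udiag_le => // i.
by rewrite lecR ler_pXn2r// nnegrE eigen_ge0.
Qed.

(** The largest eigenvalue g of G is at least the norm of G, hence at least
    lambda, and then its term g / (g + lambda) alone is at least 1/2. *)
Lemma statistical_sum_ge (i0 : 'I_m) : lambda <= mxnorm2 G ->
  1 / 2 <= \sum_i g i / (g i + lambda).
Proof.
move=> lG; have [i _ imax] := @arg_maxP _ _ _ i0 xpredT g isT.
have gi : lambda <= g i.
  by apply: le_trans lG (mxnorm2_le _ (eigen_ge0 i)) => j; exact: imax.
rewrite (bigD1 i)//= -[leLHS]addr0 lerD//.
  by rewrite ler_pdivlMr ?shifted_eigen_gt0//; lra.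
apply: sumr_ge0 => j _; rewrite divr_ge0 ?eigen_ge0// ltW//.
exact: shifted_eigen_gt0.
Qed.

End whitening.

(** * Reduction to rational vectors *)

Section qform_continuity.
Context {C : numClosedFieldType} {m : nat}.

Lemma qform_sub_le (H : 'M[C]_m) (y z : 'cV[C]_m) (M h : C) :
  (forall i, `|y i 0| <= M) -> (forall i, `|z i 0 - y i 0| <= h) -> 0 <= h -> h <= 1 ->
  `|qform H z - qform H y| <= norm1 H * ((2 * M + 1) * h).
Proof.
move=> yM zh h0 h1.
have E x : qform H x = \sum_i \sum_j H i j * ((x i 0)^* * x j 0).
  rewrite /qform mxE; under eq_bigr do rewrite mxE mulr_suml.
  rewrite exchange_big; apply: eq_bigr => i _; apply: eq_bigr => j _.
  by rewrite !mxE; ring.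
rewrite !E -sumrB /norm1 mulr_suml.
apply: le_trans (ler_norm_sum _ _ _) _; apply: ler_sum => i _.
rewrite -sumrB mulr_suml.
apply: le_trans (ler_norm_sum _ _ _) _; apply: ler_sum => j _.
rewrite -mulrBr normrM ler_wpM2l//.
have -> : (z i 0)^* * z j 0 - (y i 0)^* * y j 0 =
  (z i 0 - y i 0)^* * (z j 0 - y j 0) + (z i 0 - y i 0)^* * y j 0
  + (y i 0)^* * (z j 0 - y j 0).
  by rewrite rmorphB; ring.
have M0 : 0 <= M by apply: le_trans (yM i).
have -> : (2 * M + 1) * h = h + h * M + M * h by ring.
apply: le_trans (ler_normD _ _) _; apply: lerD.
  apply: le_trans (ler_normD _ _) _; apply: lerD.
    rewrite normrM norm_conjC -[leRHS]mulr1 ler_pM//.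
    exact: le_trans (zh j) h1.
  by rewrite normrM norm_conjC ler_pM.
by rewrite normrM norm_conjC ler_pM.
Qed.

End qform_continuity.

Section rational_points.
Context {R : realType} {n : nat}.
Local Notation C := R[i].

Definition rat_vector (q : 'cV[rat]_n * 'cV[rat]_n) : 'cV[C]_n :=
  \col_i Complex (ratr (q.1 i 0)) (ratr (q.2 i 0)).

Lemma norm_complex_le (z : C) : `|z| <= (`|Re z| + `|Im z|)%:C%C.
Proof.
rewrite normc_def lecR -(@ler_pXn2r _ 2)// ?nnegrE ?sqrtr_ge0 ?addr_ge0//.
rewrite sqr_sqrtr ?addr_ge0 ?sqr_ge0// sqrrD !real_normK ?num_real//.
have : 0 <= `|Re z| * `|Im z| by rewrite mulr_ge0.
lra.
Qed.

Lemma exists_rat_vector (x : 'cV[C]_n) (h : R) : 0 < h ->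
  exists q, forall i, `|rat_vector q i 0 - x i 0| <= h%:C%C.
Proof.
move=> h0.
have approx (a : R) : exists q : rat, `|ratr q - a| <= h / 2.
  have [|q] := @rat_in_itvoo R (a - h / 2) (a + h / 2); first lra.
  rewrite in_itv /= => /andP[q1 q2]; exists q; rewrite ler_norml; lra.
have [f fP] := choice approx.
exists (\col_i f (Re (x i 0)), \col_i f (Im (x i 0))) => i.
apply: le_trans (norm_complex_le _) _; rewrite lecR.
have -> : Re (rat_vector (\col_i f (Re (x i 0)), \col_i f (Im (x i 0))) i 0 - x i 0) =
   ratr (f (Re (x i 0))) - Re (x i 0).
  by rewrite cReB !mxE.
have -> : Im (rat_vector (\col_i f (Re (x i 0)), \col_i f (Im (x i 0))) i 0 - x i 0) =
   ratr (f (Im (x i 0))) - Im (x i 0).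
  by rewrite cImD cImN !mxE.
rewrite [leRHS](splitr h); apply: lerD; exact: fP.
Qed.

(** Rational vectors are dense and a Hermitian form is continuous.  The last
    block w is kept fixed because only the coefficients x of the least squares
    problem vary. *)
Lemma Re_qform_ge0_rat (H : 'M[C]_(n + 1)) (w : 'cV[C]_1) :
  (forall q, 0 <= Re (qform H (col_mx (rat_vector q) w))) ->
  forall x, 0 <= Re (qform H (col_mx x w)).
Proof.
move=> Hq x; rewrite leNgt; apply/negP => neg.
set y := col_mx x w in neg.
pose M : R := Re (\sum_i `|y i 0|).
have ME : M%:C%C = \sum_i `|y i 0|.
  by rewrite /M RRe_real// ger0_real// sumr_ge0.
have yM i : `|y i 0| <= M%:C%C by rewrite ME (bigD1 i)//= lerDl sumr_ge0.
have M0 : 0 <= M by rewrite -ler0c ME sumr_ge0.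
pose N1 : R := Re (norm1 H).
have NE : N1%:C%C = norm1 H by rewrite /N1 RRe_real// ger0_real// norm1_ge0.
have N10 : 0 <= N1 by rewrite -ler0c NE norm1_ge0.
pose c := - Re (qform H y).
have c0 : 0 < c by rewrite oppr_gt0.
(* A rational vector within h of x moves the form by at most h B <= c / 2, too
   little to change the sign of its real part. *)
pose B := N1 * (2 * M + 1) + 1.
have B0 : 0 < B by rewrite /B ltr_wpDl// mulr_ge0//; lra.
pose h := Num.min 1 (c / (2 * B)).
have h0 : 0 < h by rewrite lt_min ltr01 divr_gt0// mulr_gt0.
have h1 : h <= 1 by rewrite ge_min lexx.
have hB : h * B <= c / 2.
  have : h <= c / (2 * B) by rewrite ge_min lexx orbT.
  rewrite ler_pdivlMr ?mulr_gt0//; lra.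
have [q qx] := exists_rat_vector x h0.
have zy i : `|col_mx (rat_vector q) w i 0 - y i 0| <= h%:C%C.
  rewrite /y !(mxE col_mx_key); case: (fintype.split i) => j; first exact: qx.
  by rewrite subrr normr0 ler0c ltW.
have := @qform_sub_le C _ H y (col_mx (rat_vector q) w) M%:C%C h%:C%C yM zy.
have -> : (0 <= h%:C%C :> C) = true by rewrite ler0c ltW.
have -> : (h%:C%C <= 1 :> C) = true by rewrite -(rmorph1 (real_complex R)) lecR.
move=> /(_ isT isT) bnd.
have : `|Re (qform H (col_mx (rat_vector q) w) - qform H y)| <= N1 * ((2 * M + 1) * h).
  rewrite -lecR; apply: le_trans (normc_ge_Re _) _; apply: le_trans bnd _.
  by rewrite -NE !rmorphM rmorphD rmorphM rmorph1 rmorph_nat.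
rewrite cReB ler_norml => /andP[_ b2].
have := Hq q; have : N1 * ((2 * M + 1) * h) <= h * B.
  by rewrite /B; lra.
rewrite /c in hB c0 *; lra.
Qed.

End rational_points.

Lemma measurable_forall_countable d (T : measurableType d) (J : countType)
    (P : J -> T -> Prop) :
  (forall i, measurable [set t | P i t]) -> measurable [set t | forall i, P i t].
Proof.
move=> mP; rewrite (_ : [set t | _] =
  \bigcap_(k in setT) (if unpickle k is Some i then [set t | P i t] else setT)).
  by apply: bigcapT_measurable => k; case: unpickle.
apply/seteqP; split => t /=; first by move=> H k _; case: unpickle => //= i; exact: H.
by move=> H i; have := H (pickle i) I; rewrite pickleK.
Qed.

(** * Sampling from an upper bound of the leverage function *)

Lemma mxtrace_delta_mul (C : pzSemiRingType) m (A : 'M[C]_m) i j :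
  \tr (delta_mx j i *m A) = A i j.
Proof.
rewrite /mxtrace (bigD1 j)//= big1 ?addr0 => [|k /negPf kj].
  rewrite mxE (bigD1 i)//= big1 ?addr0 => [|l /negPf li].
    by rewrite mxE !eqxx mul1r.
  by rewrite mxE li andbF mul0r.
by rewrite mxE big1// => l _; rewrite mxE kj mul0r.
Qed.

Section sample_tuple.
Context d (T : measurableType d) (R : realType) (dS : measure_display)
  (S : measurableType dS) (P : probability S R) (s : nat) (eta : 'I_s -> {RV P >-> T}).

Definition sample_tuple (w : S) : s.-tuple T := [tuple eta j w | j < s].

Lemma measurable_sample_tuple : measurable_fun setT sample_tuple.
Proof.
apply/measurable_fun_tnthP => i.
rewrite (_ : _ \o _ = eta i); first exact: measurable_funPT.
by apply/funext => w /=; rewrite tnth_mktuple.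
Qed.

HB.instance Definition _ :=
  isMeasurableFun.Build _ _ _ _ sample_tuple measurable_sample_tuple.

Lemma sample_tuple_law (nu : probability T R) : mutually_independent eta ->
  (forall j B, measurable B -> P (eta j @^-1` B) = nu B) ->
  forall B : set (s.-tuple T), measurable B -> P (sample_tuple @^-1` B) = iid_law nu s B.
Proof.
move=> indep law B mB.
have -> : P (sample_tuple @^-1` B) = distribution P sample_tuple B by [].
apply: iid_law_unique => // {mB}B mB.
suff : P (sample_tuple @^-1` rect B) = (\prod_(i < s) nu (B i))%E by [].
have := indep [set: 'I_s]%SET B mB.
rewrite (_ : [set t | _] = sample_tuple @^-1` rect B); last first.
  apply/seteqP; split => w /= H i; last by move: (H i); rewrite tnth_mktuple.
  by rewrite tnth_mktuple; apply: H; rewrite inE.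
move=> ->; rewrite (eq_bigl xpredT); last by move=> i; rewrite inE.
by apply: eq_bigr => i _; exact: law.
Qed.

End sample_tuple.

Section leverage_sampling.
Context d (T : measurableType d) (R : realType).
Variables (leb mu : {measure set T -> \bar R}) (Omega : set T) (p : T -> R).
Hypotheses (mOmega : measurable Omega) (mu_p : has_density leb Omega mu p).
Context (m : nat) (F : 'I_m -> T -> R[i]) (z : T -> 'cV[R[i]]_m).
Hypotheses (LF : quasimatrix mu Omega F)
  (Lz : forall i, L2_fun mu Omega (fun t => z t i 0))
  (Fz : forall i, L2_eq mu Omega (F i) (fun t => (z t i 0)^*)).
Variables (lambda : R) (l0 : 0 <= lambda).
Local Notation G := (gram mu Omega F).
Hypothesis Gu : G + (lambda%:C)%C%:M \in unitmx.
Variables (tau : T -> R) (mtau : measurable_fun Omega tau).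
Hypothesis tau_ge : forall t, Omega t -> leverage mu Omega p F z lambda t <= tau t.
Hypothesis tau_fin : (\int[leb]_(t in Omega) (tau t)%:E < +oo)%E.
Variables (U : 'M[R[i]]_m) (g : 'I_m -> R).
Hypotheses (UU : U \is unitarymx) (GE : G = udiag U (fun i => (g i)%:C%C)).

Let pG : psd G. Proof. exact: gram_psd. Qed.

(** The squared norm of this vector is the leverage function divided by the
    density p; see [leverageE]. *)
Definition whitened t := whitener U g lambda *m z t.

Lemma leverageE t : leverage mu Omega p F z lambda t = p t * Re (qform 1 (whitened t)).
Proof. by rewrite /whitened (qform1_whitener UU GE pG l0 Gu). Qed.

Lemma Re_qform1_ge0 n (y : 'cV[R[i]]_n) : 0 <= Re (qform 1 y).
Proof. exact: (@ler_Re _ 0 _ (qform1_ge0 _)). Qed.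

Lemma Re_qform1K n (y : 'cV[R[i]]_n) : (Re (qform 1 y))%:C%C = qform 1 y.
Proof. by rewrite RRe_real// ger0_real// qform1_ge0. Qed.

Let density_ge0 t : Omega t -> 0 <= p t. Proof. by have [_ + _] := mu_p; exact. Qed.

Lemma leverage_ge0 t : Omega t -> 0 <= leverage mu Omega p F z lambda t.
Proof. by move=> Ot; rewrite leverageE mulr_ge0 ?Re_qform1_ge0// density_ge0. Qed.

Lemma tau_ge0 t : Omega t -> 0 <= tau t.
Proof. by move=> Ot; apply: le_trans (tau_ge Ot); exact: leverage_ge0. Qed.

Lemma tau_integrable : leb.-integrable Omega (EFin \o tau).
Proof.
apply/integrableP; split; first exact/measurable_EFinP.
apply: le_lt_trans tau_fin; rewrite le_eqVlt; apply/orP; left; apply/eqP.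
by apply: eq_integral => t; rewrite inE => Ot /=; rewrite ger0_norm// tau_ge0.
Qed.

Lemma mxmeasurable_coord : mxmeasurable Omega z.
Proof. by move=> i j; rewrite ord1; have [] := Lz i. Qed.

Lemma mxmeasurable_whitened : mxmeasurable Omega whitened.
Proof. by apply: mxmeasurable_mulmx => //; exact: mxmeasurable_coord. Qed.

Lemma mxmeasurable_outer_whitened : mxmeasurable Omega (fun t => outer (whitened t)).
Proof.
apply: mxmeasurable_mulmx => //; first exact: mxmeasurable_whitened.
exact: mxmeasurable_adj mxmeasurable_whitened.
Qed.

Lemma outer_whitened_integral i j :
  cintegrable mu Omega (fun t => outer (whitened t) i j) /\
  cintegral mu Omega (fun t => outer (whitened t) i j) = whitened_gram g lambda i j.
Proof.
set W := whitener U g lambda.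
(* Each entry of W X W^H is the trace of a fixed matrix against X, so it
   integrates entrywise. *)
pose V := W^t* *m delta_mx j i *m W.
have E (B : 'M[R[i]]_m) : (W *m B *m W^t*) i j = \tr (V * B).
  by rewrite /V -mulmxE -!mulmxA mxtrace_mulC -!mulmxA mxtrace_delta_mul !mulmxA.
have oE t : outer (whitened t) i j = \tr (V * outer (z t)).
  by rewrite -E /outer /whitened trmx_mul map_mxM !mulmxA.
have zint k l := gram_coord mOmega LF Lz Fz k l.
have [I1 I2] := cintegral_mxtrace mOmega V (fun k l => (zint k l).1) (fun k l => (zint k l).2).
under eq_fun do rewrite oE; split => //.
by rewrite I2 -E (whitener_gram UU GE pG l0 Gu).
Qed.

(** The integral of p |T z|^2 is the trace of the integral of the rank-one
    matrices of T z. *)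
Lemma leverage_integral :
  leb.-integrable Omega (EFin \o leverage mu Omega p F z lambda) /\
  \int[leb]_(t in Omega) leverage mu Omega p F z lambda t = Re (\tr (whitened_gram g lambda)).
Proof.
have [I1 I2] := cintegral_mxtrace mOmega (1 : 'M[R[i]]_m)
  (fun k l => (outer_whitened_integral k l).1) (fun k l => (outer_whitened_integral k l).2).
have levE t : leverage mu Omega p F z lambda t = Re ((p t)%:C%C * \tr (1 * outer (whitened t))).
  rewrite leverageE cReZ mul1r /outer mxtrace_mulC; congr (_ * Re _).
  by rewrite /qform mulmx1 /mxtrace big_ord1.
have mf : cmeasurable Omega (fun t => \tr (1 * outer (whitened t))).
  apply: cmeasurable_mxtrace => //; under eq_fun do rewrite mul1r.
  exact: mxmeasurable_outer_whitened.
have [J1 _] := (cintegrable_has_density mOmega mu_p mf).1 I1.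
split.
  by apply: eq_integrable J1 => // t _ /=; rewrite levE.
rewrite -[X in \tr X]mul1r -I2 (cintegral_has_density mOmega mu_p mf).
by apply: eq_Rintegral => t _; rewrite levE.
Qed.

Lemma statistical_dimE :
  statistical_dim mu Omega F lambda = Re (\tr (whitened_gram g lambda)).
Proof.
by rewrite /statistical_dim (trace_invmx_shifted UU GE pG l0 Gu) trace_whitened_gram.
Qed.

Variables (s : nat) (s0 : (0 < s)%N).
Local Notation s_tau := (\int[leb]_(t in Omega) tau t)%R.
Local Notation p_tau := (fun t => tau t / s_tau).
Hypothesis stat_gt0 : 0 < Re (\tr (whitened_gram g lambda)).

Lemma s_tau_ge : Re (\tr (whitened_gram g lambda)) <= s_tau.
Proof.
have [I1 <-] := leverage_integral.
by apply: le_Rintegral => //; exact: tau_integrable.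
Qed.

Lemma s_tau_gt0 : 0 < s_tau.
Proof. exact: lt_le_trans s_tau_ge. Qed.

Lemma p_tau_ge0 t : Omega t -> 0 <= p_tau t.
Proof. by move=> Ot; rewrite divr_ge0 ?tau_ge0// ltW// s_tau_gt0. Qed.

Lemma measurable_p_tau : measurable_fun Omega p_tau.
Proof. exact: measurable_funM. Qed.

Local Notation weight := (sample_weight s p p_tau).

Lemma weight_sqr t : Omega t -> weight t ^+ 2 = p t / (s%:R * p_tau t).
Proof.
by move=> Ot; rewrite sqr_sqrtr// divr_ge0 ?density_ge0// mulr_ge0// p_tau_ge0.
Qed.

Lemma measurable_weight : measurable_fun Omega weight.
Proof.
apply: (@measurableT_comp _ _ _ _ _ _ (@Num.sqrt R)).
  by apply: nondecreasing_measurable => // a b; exact: ler_wsqrtr.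
apply: measurable_funM; first by have [] := mu_p.
(* The real power with exponent -1 is measurable and equals the inverse on
   nonnegative numbers. *)
apply: (eq_measurable_fun (fun t => (s%:R * p_tau t) `^ (-1))).
  by move=> t; rewrite inE => Ot; rewrite powR_inv1// mulr_ge0// p_tau_ge0.
apply: (measurableT_comp (measurable_powR (-1))).
by apply: measurable_funM => //; exact: measurable_p_tau.
Qed.

(** Importance sampling undoes the change of density wherever p_tau is
    positive.  Where p_tau vanishes the weight is meaningless, but there tau
    and hence the leverage function p |T z|^2 vanish too, so nothing is lost in
    the mean of the rank-one matrices. *)
Lemma density_weight t : Omega t ->
  p_tau t * weight t ^+ 2 = s%:R^-1 * p t \/
  (p_tau t * weight t ^+ 2 = 0 /\ (p t = 0 \/ whitened t = 0)).
Proof.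
move=> Ot; rewrite weight_sqr//; have st := s_tau_gt0.
have sn : s%:R != 0 :> R by rewrite pnatr_eq0 -lt0n.
have [t0|t0] := eqVneq (tau t) 0.
  right; rewrite t0 mul0r mul0r; split => //.
  have := tau_ge Ot; rewrite leverageE t0 => le0.
  have : p t * Re (qform 1 (whitened t)) = 0.
    by apply/eqP; rewrite eq_le le0 mulr_ge0 ?Re_qform1_ge0// density_ge0.
  move/eqP; rewrite mulf_eq0 => /orP[/eqP|/eqP q0]; [by left|right].
  have : qform 1 (whitened t) = 0 by rewrite -Re_qform1K q0.
  rewrite qform1 => /eqP; rewrite psumr_eq0 => [|i _]; last by rewrite exprn_ge0.
  move=> /allP all0; apply/matrixP => i j; rewrite ord1 [RHS]mxE; apply/eqP.
  have := all0 i (mem_index_enum _).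
  by rewrite expf_eq0 /= normr_eq0.
by left; field; rewrite t0 sn gt_eqF.
Qed.

(** The whitened and weighted sample.  It is extended by 0 outside Omega to be
    measurable on the whole space. *)
Definition sampled_vector : T -> 'cV[R[i]]_m :=
  patch (fun=> 0) Omega (fun t => (weight t)%:C%C *: whitened t).

Lemma sampled_vectorE t : Omega t -> sampled_vector t = (weight t)%:C%C *: whitened t.
Proof. by move=> Ot; rewrite /sampled_vector /patch mem_set. Qed.

Lemma sampled_vector_notin t : ~ Omega t -> sampled_vector t = 0.
Proof. by move=> Ot; rewrite /sampled_vector /patch memNset. Qed.

Lemma cmeasurable_patch (f : T -> R[i]) : cmeasurable Omega f ->
  cmeasurable setT (patch (fun=> 0) Omega f).
Proof.
move=> [f1 f2]; split.
  rewrite (_ : (fun t => _) = (fun t => Re (f t)) \_ Omega).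
    exact/(measurable_restrictT _ mOmega).
  by apply/funext => t; rewrite /patch; case: ifP.
rewrite (_ : (fun t => _) = (fun t => Im (f t)) \_ Omega).
  exact/(measurable_restrictT _ mOmega).
by apply/funext => t; rewrite /patch; case: ifP.
Qed.

Lemma cintegral_patch (nu : {measure set T -> \bar R}) (f : T -> R[i]) :
  cintegrable nu Omega f ->
  cintegrable nu setT (patch (fun=> 0) Omega f) /\
  cintegral nu setT (patch (fun=> 0) Omega f) = cintegral nu Omega f.
Proof.
have E1 : (fun t => Re (patch (fun=> 0) Omega f t)) = (fun t => Re (f t)) \_ Omega.
  by apply/funext => t; rewrite /patch; case: ifP.
have E2 : (fun t => Im (patch (fun=> 0) Omega f t)) = (fun t => Im (f t)) \_ Omega.
  by apply/funext => t; rewrite /patch; case: ifP.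
move=> [I1 I2]; split.
  split; rewrite ?E1 ?E2 -restrict_EFin.
    exact/(integrable_mkcond _ mOmega).
  exact/(integrable_mkcond _ mOmega).
by rewrite /cintegral E1 E2 -!Rintegral_mkcond.
Qed.

Lemma mxmeasurable_sampled_vector : mxmeasurable setT sampled_vector.
Proof.
move=> i j; rewrite (_ : (fun t => _) =
    patch (fun=> 0) Omega (fun t => ((weight t)%:C%C *: whitened t) i j)).
  apply: cmeasurable_patch; 
  exact: (mxmeasurableZ (cmeasurable_real measurable_weight) mxmeasurable_whitened).
by apply/funext => t; rewrite /sampled_vector /patch; case: ifP; rewrite ?mxE.
Qed.

Lemma outer_scale (w : R) (y : 'cV[R[i]]_m) : outer (w%:C%C *: y) = (w ^+ 2)%:C%C *: outer y.
Proof.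
rewrite /outer linearZ /= map_mxZ [X in _ *m (X *: _)](conj_real_complex w).
by rewrite -scalemxAl -scalemxAr scalerA -rmorphM -expr2.
Qed.

Lemma qform1_scale (w : R) (y : 'cV[R[i]]_m) :
  qform 1 (w%:C%C *: y) = (w ^+ 2)%:C%C * qform 1 y.
Proof.
rewrite !qform1 mulr_sumr; apply: eq_bigr => i _.
by rewrite mxE normrM exprMn normc_real_sqr.
Qed.

(** The squared norm is p |T z|^2 / tau times s_tau / s, and tau dominates the
    leverage function. *)
Lemma sampled_vector_le t : qform 1 (sampled_vector t) <= (s_tau / s%:R)%:C%C.
Proof.
have s0' : 0 < s%:R :> R by rewrite ltr0n.
have st := s_tau_gt0.
have [Ot|Ot] := pselect (Omega t); last first.
  rewrite sampled_vector_notin// qform1 big1 => [|i _]; last by rewrite mxE normr0 expr0n.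
  by rewrite ler0c divr_ge0 ?ltW.
rewrite sampled_vectorE// qform1_scale -Re_qform1K -rmorphM lecR weight_sqr//.
have [t0|t0] := eqVneq (tau t) 0.
  by rewrite t0 mul0r mulr0 invr0 mulr0 mul0r divr_ge0 ?ltW.
have tp : 0 < tau t by rewrite lt_def t0 tau_ge0.
have := tau_ge Ot; rewrite leverageE => h.
have -> : p t / (s%:R * (tau t / s_tau)) * Re (qform 1 (whitened t)) =
   (p t * Re (qform 1 (whitened t))) / tau t * (s_tau / s%:R).
  by field; rewrite !gt_eqF.
apply: ler_piMl; first by rewrite divr_ge0 ?ltW.
by rewrite ler_pdivrMr// mul1r.
Qed.

Lemma sampled_vector_mean (nu : {measure set T -> \bar R}) :
  has_density leb Omega nu p_tau -> forall i j,
  cintegrable nu setT (fun t => outer (sampled_vector t) i j) /\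
  cintegral nu setT (fun t => outer (sampled_vector t) i j) =
    ((s%:R^-1)%:C%C *: whitened_gram g lambda) i j.
Proof.
move=> nu_q i j; have [I1 I2] := outer_whitened_integral i j.
have mo : cmeasurable Omega (fun t => outer (whitened t) i j).
  exact: mxmeasurable_outer_whitened.
have J1 := (cintegrable_has_density mOmega mu_p mo).1 I1.
pose f t := (weight t ^+ 2)%:C%C * outer (whitened t) i j.
have mf : cmeasurable Omega f.
  apply: cmeasurableM => //; apply: cmeasurable_real.
  by apply: measurable_funX; exact: measurable_weight.
have fE : {in Omega, (fun t => (s%:R^-1)%:C%C * ((p t)%:C%C * outer (whitened t) i j)) =1
   (fun t => (p_tau t)%:C%C * f t)}.
  move=> t; rewrite inE => Ot; rewrite /f !mulrA -!rmorphM.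
  have [->//|[-> [->|->]]] := density_weight Ot.
    by rewrite mulr0.
  by rewrite /outer mul0mx mxE !mulr0.
have If : cintegrable nu Omega f.
  apply/(cintegrable_has_density mOmega nu_q mf).
  have J2 := cintegrableZ mOmega (s%:R^-1)%:C%C J1.
  exact: (eq_cintegrable mOmega fE J2).
have -> : (fun t => outer (sampled_vector t) i j) = patch (fun=> 0) Omega f.
  apply/funext => t; rewrite /patch; case: ifPn => [/set_mem Ot|/negP Ot].
    by rewrite sampled_vectorE// outer_scale mxE.
  rewrite sampled_vector_notin; last by move=> Ot'; apply: Ot; rewrite inE.
  by rewrite /outer mul0mx mxE.
have [J3 ->] := cintegral_patch If; split => //.
rewrite (cintegral_has_density mOmega nu_q mf) -(eq_cintegral _ fE) cintegralZ//.
by rewrite [RHS]mxE -(cintegral_has_density mOmega mu_p mo) I2.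
Qed.

End leverage_sampling.

(** * The regularized least squares problem *)

Section coordinates.
Context d (T : measurableType d) (R : realType).
Variables (mu : {measure set T -> \bar R}) (Omega : set T).
Hypothesis mOmega : measurable Omega.

Lemma coord_rep_L2 n (A : 'I_n -> T -> R[i]) (z : T -> 'cV[R[i]]_n) :
  coord_rep mu Omega A z -> forall i, L2_fun mu Omega (fun t => z t i 0).
Proof.
move=> [mz zfin _] i; split => //; apply: le_lt_trans zfin.
have mn j : measurable_fun Omega (fun t => Normc.normc (z t j 0) ^+ 2).
  under eq_fun do rewrite normc_sqr.
  by have [m1 m2] := mz j; apply: measurable_funD; exact: measurable_funX.
have vE t : vnorm2 (z t) ^+ 2 = \sum_j Normc.normc (z t j 0) ^+ 2.
  by rewrite sqr_sqrtr// sumr_ge0// => j _; exact: sqr_ge0.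
apply: ge0_le_integral => //.
- by move=> t _; rewrite lee_fin sqr_ge0.
- exact/measurable_EFinP.
- apply/measurable_EFinP; under eq_fun do rewrite vE.
  by apply: measurable_sum => j; exact: mn.
- move=> t _; rewrite lee_fin vE (bigD1 i)//= lerDl sumr_ge0// => j _.
  exact: sqr_ge0.
Qed.

Lemma coord_rep_ae n (A : 'I_n -> T -> R[i]) (z : T -> 'cV[R[i]]_n) :
  coord_rep mu Omega A z -> forall i, L2_eq mu Omega (A i) (fun t => (z t i 0)^*).
Proof.
move=> [_ _ rep] i; have := rep (delta_mx i 0); apply: filterS => t H Ot.
have := H Ot; rewrite /qapply (bigD1 i)//= big1 => [|j /negPf ji]; last first.
  by rewrite mxE ji mul0r.
rewrite (bigD1 i)//= big1 => [|j /negPf ji]; last by rewrite mxE ji mul0r.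
by rewrite !addr0 mxE !eqxx !mul1r.
Qed.

End coordinates.

Section append.
Context d (T : measurableType d) (R : realType) (n : nat).
Variables (A : 'I_n -> T -> R[i]) (b : T -> R[i]).

(** Homogeneous coordinates: [A b] (x; -1) = Ax - b. *)
Definition homog (x : 'cV[R[i]]_n) : 'cV[R[i]]_(n + 1) := col_mx x (const_mx (- 1)).

Lemma qapply_homog x t : qapply (append_column A b) (homog x) t = qapply A x t - b t.
Proof.
rewrite /qapply big_split_ord /=; congr (_ + _).
  apply: eq_bigr => j _; rewrite /homog col_mxEu /append_column.
  by rewrite -/(lshift 1 j) (unsplitK (inl j)).
rewrite big_ord1 /homog col_mxEd mxE /append_column.
by rewrite -/(rshift n _) (unsplitK (inr _)) mulN1r.
Qed.

Lemma qform1_homog x : qform 1 (homog x) = (vnorm2 x ^+ 2 + 1)%:C%C.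
Proof.
rewrite qform1 big_split_ord big_ord1 /= [RHS]rmorphD /= vnorm2_sqr qform1; congr (_ + _).
  by apply: eq_bigr => i _; rewrite col_mxEu.
by rewrite col_mxEd mxE normrN1 expr1n rmorph1.
Qed.

Variables (zA : T -> 'cV[R[i]]_n) (zb : T -> R[i]).
Local Notation z := (fun u => col_mx (zA u) (zb u)%:M : 'cV[R[i]]_(n + 1)).

Lemma sampled_residual s (p q : T -> R) (eta : 'I_s -> T) x j :
  (sampled_mx p q zA eta *m x - sampled_vec p q zb eta) j 0 =
  (sample_weight s p q (eta j))%:C%C * ((z (eta j))^t* *m homog x) 0 0.
Proof.
rewrite !mxE big_split_ord big_ord1 /= mulrDr; congr (_ + _).
  rewrite mulr_sumr; apply: eq_bigr => i _.
  by rewrite !mxE -/(lshift 1 i) (unsplitK (inl i)) !mulrA; congr (_ * _); rewrite !mxE.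
by rewrite col_mxEd !mxE -/(rshift n _) (unsplitK (inr _)) !mxE eqxx mulr1n mulrN1 mulrN.
Qed.

Lemma sampled_residual_norm s (p q : T -> R) (eta : 'I_s -> T) x :
  (vnorm2 (sampled_mx p q zA eta *m x - sampled_vec p q zb eta) ^+ 2)%:C%C =
  qform (\sum_j ((sample_weight s p q (eta j)) ^+ 2)%:C%C *: outer (z (eta j))) (homog x).
Proof.
rewrite vnorm2_sqr qform1 qform_sum; apply: eq_bigr => j _.
by rewrite sampled_residual normrM exprMn normc_real_sqr qformZ qform_outer.
Qed.

End append.

Lemma relative_errorE (R : realDomainType) (eps e a r1 r2 : R) :
  ((1 - eps) * (e + r1 + r2) <= a + r1 + r2 /\
   a + r1 + r2 <= (1 + eps) * (e + r1 + r2)) <->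
  `|a - e| <= eps * (e + r1 + r2).
Proof.
rewrite ler_norml; split=> [[h1 h2]|/andP[h1 h2]]; first apply/andP; split; lra.
Qed.

Theorem lemma11 (R : realType) (d n : nat)
  (Omega : set (Rspace R d)) (mOmega : measurable Omega)
  (mu : probability (Rspace R d) R) (p : Rspace R d -> R)
  (mu_p : has_density (lebesgue_Rd d) Omega mu p)
  (A : 'I_n -> Rspace R d -> R[i]) (A_L2 : quasimatrix mu Omega A)
  (b : Rspace R d -> R[i]) (b_L2 : L2_fun mu Omega b)
  (lambda : R) (lambda_ge0 : 0 <= lambda)
  (A_full : lambda = 0 -> full_rank mu Omega A)
  (zA : Rspace R d -> 'cV[R[i]]_n) (zA_rep : coord_rep mu Omega A zA)
  (zb : Rspace R d -> R[i])
  (zb_rep : coord_rep mu Omega (column_quasimatrix b) (fun t => (zb t)%:M))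
  (G_unit : gram mu Omega (append_column A b) + (lambda%:C)%C%:M \in unitmx)
  (G_norm : lambda <= mxnorm2 (gram mu Omega (append_column A b)))
  (tau : Rspace R d -> R) (mtau : measurable_fun Omega tau)
  (tau_ge : forall t, Omega t ->
    leverage mu Omega p (append_column A b)
      (fun u => col_mx (zA u) (zb u)%:M) lambda t <= tau t)
  (tau_fin : (\int[lebesgue_Rd d]_(t in Omega) (tau t)%:E < +oo)%E)
  (dS : measure_display) (S : measurableType dS) (P : probability S R)
  (s : nat) (eta : 'I_s -> {RV P >-> Rspace R d})
  (eta_Omega : forall j w, Omega (eta j w))
  (eta_indep : mutually_independent eta)
  (eps delta : R) (eps_gt0 : 0 < eps) (eps_le : eps <= 1 / 2)
  (delta_gt0 : 0 < delta) (delta_lt1 : delta < 1) :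
  let s_tau := (\int[lebesgue_Rd d]_(t in Omega) tau t)%R in
  let p_tau := fun t => tau t / s_tau in
  (forall j, has_density (lebesgue_Rd d) Omega (distribution P (eta j)) p_tau) ->
  8 / 3 * s_tau * eps ^- 2 *
    ln (16 * statistical_dim mu Omega (append_column A b) lambda / delta)
    <= s%:R ->
  ((1 - delta)%:E <= P [set w | (forall x : 'cV[R[i]]_n,
    let A_eta := sampled_mx p p_tau zA (fun j => eta j w) in
    let b_eta := sampled_vec p p_tau zb (fun j => eta j w) in
    let exact := L2_norm mu Omega (fun t => qapply A x t - b t) ^+ 2
                 + lambda * vnorm2 x ^+ 2 + lambda in
    let approx := vnorm2 (A_eta *m x - b_eta) ^+ 2
                  + lambda * vnorm2 x ^+ 2 + lambda in
    (1 - eps) * exact <= approx /\ approx <= (1 + eps) * exact)%R])%E.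
Proof.
set F := append_column A b in G_unit G_norm tau_ge *.
set z := (fun u => col_mx (zA u) (zb u)%:M) in tau_ge *.
move=> s_tau p_tau eta_law ln_le.
have LF : quasimatrix mu Omega F.
  by move=> k; rewrite /F /append_column; case: (fintype.split k).
have Lz k : L2_fun mu Omega (fun t => z t k 0).
  rewrite -(splitK k); case: (fintype.split k) => i /=.
    by under eq_fun do rewrite /z col_mxEu; exact: coord_rep_L2 zA_rep i.
  by under eq_fun do rewrite /z col_mxEd; exact: coord_rep_L2 zb_rep i.
have Fz k : L2_eq mu Omega (F k) (fun t => (z t k 0)^*).
  rewrite /F /append_column; case: (fintype.split k) (splitK k) => i <- /=.
    have := coord_rep_ae zA_rep i; apply: filterS => t H Ot.
    by rewrite /z col_mxEu H.
  have := coord_rep_ae zb_rep i; apply: filterS => t H Ot.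
  by rewrite /z col_mxEd -H.
have [U [g [UU GE]]] := herm_spectralR (gram_herm mOmega LF).
have pG := gram_psd mOmega LF.
set G := gram mu Omega F in G_unit G_norm GE pG *.
have i0 : 'I_(n + 1) := rshift n ord0.
have stat2 := statistical_sum_ge UU GE pG lambda_ge0 G_unit i0 G_norm.
set wg := whitened_gram g lambda.
have slE : statistical_dim mu Omega F lambda = Re (\tr wg).
  exact: statistical_dimE UU GE.
have sl2 : 1 / 2 <= Re (\tr wg) by rewrite /wg trace_whitened_gram.
have sl0 : 0 < Re (\tr wg) by apply: lt_le_trans sl2; rewrite divr_gt0.
have st0 : 0 < s_tau.
  exact: (s_tau_gt0 mOmega mu_p LF Lz Fz lambda_ge0 G_unit mtau tau_ge tau_fin UU GE sl0).
have stat16_gt : 1 * delta < 16 * Re (\tr wg).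
  by move: delta_lt1 sl2; move: (Re _) => r; lra.
(* The lower bound on s is positive: its logarithm has an argument above 1. *)
have s_gt0 : (0 < s)%N.
  rewrite lt0n; apply/negP => /eqP s_eq0; move: ln_le; apply/negP; rewrite -ltNge.
  rewrite s_eq0 mulr_gt0//.
    by rewrite mulr_gt0 ?invr_gt0 ?exprn_gt0// mulr_gt0.
  by rewrite slE ln_gt0// ltr_pdivlMr//; exact: stat16_gt.
have s0' : 0 < s%:R :> R by rewrite ltr0n.
pose nu : probability (Rspace R d) R := distribution P (eta (Ordinal s_gt0)).
have law j B : measurable B -> P (eta j @^-1` B) = nu B.
  move=> mB; have [_ _ /(_ B mB) E1] := eta_law j.
  by have [_ _ /(_ B mB) E2] := eta_law (Ordinal s_gt0); rewrite /nu /= E2 -E1.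
pose y := @sampled_vector _ _ R (lebesgue_Rd d) Omega p _ z lambda tau U g s.
have my : mxmeasurable setT y.
  exact: (mxmeasurable_sampled_vector mOmega mu_p LF Lz Fz lambda_ge0 G_unit
    mtau tau_ge tau_fin UU GE s sl0).
have yL t : qform 1 (y t) <= (s_tau / s%:R)%:C%C.
  exact: (sampled_vector_le mOmega mu_p LF Lz Fz lambda_ge0 G_unit
    mtau tau_ge tau_fin UU GE s_gt0 sl0).
pose K := (s%:R^-1)%:C%C *: wg.
have ymean := sampled_vector_mean mOmega mu_p LF Lz Fz lambda_ge0 G_unit mtau tau_ge tau_fin
  UU GE s_gt0 sl0 (eta_law (Ordinal s_gt0)).
have KE : (s%:R)%:C%C *: K = wg.
  rewrite /K scalerA -rmorphM mulfV; last by rewrite gt_eqF.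
  by rewrite rmorph1 scale1r.
have qK v : s%:R * qform K v = qform wg v.
  by rewrite -[in RHS]KE (qformZ (s%:R)%:C%C K) rmorph_nat.
have hK : K^t* = K.
  rewrite /K linearZ /= map_mxZ whitened_gram_herm; congr (_ *: _).
  exact: conj_real_complex.
have si0 : 0 <= (s%:R^-1)%:C%C :> R[i] by rewrite ler0c invr_ge0 ltW.
have pK : psd K.
  by move=> v; rewrite qformZ mulr_ge0// (whitened_gram_psd UU GE pG lambda_ge0 G_unit).
have K1 : psd ((1 : 'M[R[i]]_(n + 1)) - (s%:R)%:C%C *: K).
  by rewrite KE; exact: (whitened_gram_le1 UU GE pG lambda_ge0 G_unit).
have L0 : 0 < s_tau / s%:R by rewrite divr_gt0.
have lnL : 8 / 3 * (s_tau / s%:R) * eps ^- 2 *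
    ln (16 * Re (\tr ((s%:R)%:C%C *: K)) / delta) <= 1.
  rewrite KE -slE.
  rewrite (_ : _ * ln _ = 8 / 3 * s_tau * eps ^- 2 *
    ln (16 * statistical_dim mu Omega F lambda / delta) / s%:R); last by ring.
  by rewrite ler_pdivrMr// mul1r.
have sl2K : 1 / 2 <= Re (\tr ((s%:R)%:C%C *: K)) by rewrite KE.
have [B [mB B_le B_good]] := matrix_chernoff (nu := nu) s_gt0 my yL L0 hK pK K1
  (fun i j => (ymean i j).1) (fun i j => (ymean i j).2) eps_gt0 eps_le delta_gt0 delta_lt1
  sl2K lnL.
(* In the whitened coordinates v x the sampled form is the sum of the
   rank-one matrices, the exact form is whitened_gram, and the total with its
   ridge terms is the squared norm; the matrix bound is the claim. *)
pose v x := unwhiten U g lambda (homog x).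
pose ex x := L2_norm mu Omega (fun t => qapply A x t - b t) ^+ 2.
pose al w x := vnorm2 (sampled_mx p p_tau zA (fun j => eta j w) *m x
  - sampled_vec p p_tau zb (fun j => eta j w)) ^+ 2.
pose tot x := ex x + lambda * vnorm2 x ^+ 2 + lambda.
have exE x : (ex x)%:C%C = qform G (homog x).
  rewrite -(L2_norm_qapply mOmega LF) /ex; congr ((L2_norm mu Omega _ ^+ 2)%:C%C).
  by apply/funext => t; rewrite /F qapply_homog.
have totE x : (tot x)%:C%C = qform (G + (lambda%:C)%C%:M) (homog x).
  rewrite qformD -exE -scalemx1 qformZ (qform1_homog x) -rmorphM -rmorphD.
  by rewrite /tot mulrDr mulr1 addrA.
have alE w x : (al w x)%:C%C = qform (\sum_j ((sample_weight s p p_tau (eta j w)) ^+ 2)%:C%C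
    *: outer (z (eta j w))) (homog x).
  exact: sampled_residual_norm.
have alE2 w x : (al w x)%:C%C = qform (\sum_j outer (y (eta j w))) (v x).
  rewrite alE !qform_sum; apply: eq_bigr => j _.
  rewrite /y sampled_vectorE// outer_scale !qformZ !qform_outer.
  rewrite /whitened trmx_mul map_mxM -mulmxA.
  by rewrite (adj_whitener_unwhiten UU GE pG lambda_ge0 G_unit).
have close w x : ~ B (sample_tuple eta w) -> `|al w x - ex x| <= eps * tot x.
  move=> nB; have := B_good _ nB (v x).
  rewrite qK (qform_whitened_gram UU GE pG lambda_ge0 G_unit) -exE.
  rewrite (qform1_unwhiten UU GE pG lambda_ge0 G_unit) -totE big_tuple.
  under eq_bigr do rewrite tnth_mktuple.
  rewrite -alE2 -rmorphB -rmorphM normc_def /= expr0n addr0 sqrtr_sqr lecR.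
  exact.
set E := [set w | _].
have EE : E = [set w | forall x, `|al w x - ex x| <= eps * tot x].
  by apply/seteqP; split => w /= H x; apply/relative_errorE; exact: H.
have mSy : mxmeasurable setT (fun w => \sum_j outer (y (eta j w))).
  apply: mxmeasurable_sum => j.
  have myj : mxmeasurable setT (fun w => y (eta j w)).
    move=> k l; have [h1 h2] := my k l; split.
      by apply: (measurableT_comp h1); exact: measurable_funPT.
    by apply: (measurableT_comp h2); exact: measurable_funPT.
  by apply: mxmeasurable_mulmx => //; exact: mxmeasurable_adj.
have mal x : measurable_fun setT (fun w => al w x).
  rewrite (_ : (fun w => al w x) =
      (fun w => Re (qform (\sum_j outer (y (eta j w))) (v x)))); last first.
    by apply/funext => w; rewrite -alE2.
  suff mq : mxmeasurable setT (fun w =>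
      (v x)^t* *m (\sum_j outer (y (eta j w))) *m v x) by have [] := mq 0 0.
  apply: mxmeasurable_mulmx; last exact: mxmeasurable_cst.
  by apply: mxmeasurable_mulmx => //; exact: mxmeasurable_cst.
have mE : measurable E.
  have -> : E = [set w | forall q, `|al w (rat_vector q) - ex (rat_vector q)|
      <= eps * tot (rat_vector q)].
    rewrite EE; apply/seteqP; split => w /= H; first by move=> q; exact: H.
    set Sw := \sum_j ((sample_weight s p p_tau (eta j w)) ^+ 2)%:C%C *: outer (z (eta j w)).
    pose Gl := G + (lambda%:C)%C%:M.
    (* Each of the two inequalities says that a Hermitian form is nonnegative
       at homog x. *)
    have side (e : R) x : Re (qform (e%:C%C *: (Sw - G) + eps%:C%C *: Gl) (homog x)) =
        e * (al w x - ex x) + eps * tot x.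
      rewrite qformD !qformZ qformB -alE -exE -totE -rmorphB -!rmorphM -rmorphD.
      by [].
    move=> x; rewrite ler_norml lerNl; apply/andP; split.
      have := Re_qform_ge0_rat (H := 1%:C%C *: (Sw - G) + eps%:C%C *: Gl)
        (w := const_mx (- 1)) _ x.
      rewrite -/(homog x) side mul1r => h.
      rewrite -subr_ge0 opprK addrC; apply: h => q.
      have := H q; rewrite -/(homog _) side mul1r ler_norml => /andP[h _].
      by rewrite -lerBlDr sub0r.
    have := Re_qform_ge0_rat (H := (- 1)%:C%C *: (Sw - G) + eps%:C%C *: Gl)
      (w := const_mx (- 1)) _ x.
    rewrite -/(homog x) side mulN1r => h.
    rewrite -subr_ge0 addrC; apply: h => q.
    have := H q; rewrite -/(homog _) side mulN1r ler_norml => /andP[_ h].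
    by rewrite addrC subr_ge0.
  apply: measurable_forall_countable => q.
  rewrite (_ : [set w | _] = [set w | 0 <= eps * tot (rat_vector q)
      - `|al w (rat_vector q) - ex (rat_vector q)|]); last first.
    by apply/seteqP; split => w /=; rewrite subr_ge0.
  apply: measurable_ge_level; apply: measurable_funB => //.
  by apply: measurableT_comp => //; exact: measurable_funB.
have mpre : measurable (sample_tuple eta @^-1` B).
  by rewrite -[X in measurable X]setTI; exact: measurable_sample_tuple.
apply: (@le_trans _ _ (P (~` (sample_tuple eta @^-1` B)))).
  rewrite probability_setC// (sample_tuple_law eta_indep law mB) EFinB.
  exact: leeB.
apply: le_measure; rewrite ?inE//; first exact: measurableC.
by rewrite EE => w /= nB x; exact: close.
Qed.
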